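(* Consider the semi-discrete poroelasticity system $$A u - D^T p = f,\qquad D\dot u + C\dot p + B p = g \quad\text{on } [0,T],\qquad u(0)=u^0,\ p(0)=p^0,$$ with matrices $A,B,C,D$ and coupling parameter $\omega$ as defined in the context. Let its solution $(u,p)$ satisfy $u\in C^2([0,T],\mathbb{R}^{n_u})$ and $p\in C^2([0,T],\mathbb{R}^{n_p})$. Assume moreover that $f\in C^2([0,T],\mathbb{R}^{n_u})$ and $g\in C^1([0,T],\mathbb{R}^{n_p})$, that the initial data are consistent, i.e. $A u^0 - D^T p^0 = f(0)$, that $$B p^0 = g(0) - D A^{-1}\dot f(0) + \mathcal{O}(\tau),$$ and that the number of inner iterations $K\in\mathbb{N}$, $K\ge1$, satisfies $$\frac{\omega^K}{(2+\omega)^{K-1}} < 1 .$$ Then the damped iterative scheme with $K$ inner iterations and step size $\tau$ (defined in the context) converges with order one. More precisely, its iterates $(u^n,p^n)$ satisfy, for all $0\le n\le N$, $$\|u^n-u(t^n)\|_A^2+\|p^n-p(t^n)\|_B^2\le \mathfrak{C}\,\tau^2$$ with a positive constant $\mathfrak{C}>0$ depending on the solution, the right-hand sides, the time horizon $T$, and the material parameters (and not on $\tau$ or $n$).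
   Context: Continuous setting. $\Omega\subseteq\mathbb{R}^m$, $m\in\{2,3\}$, is a bounded Lipschitz domain, $T>0$. The material parameters $\lambda,\mu$ (Lamé coefficients), $\alpha$ (Biot--Willis coefficient), $M$ (Biot modulus), $\kappa$ (permeability), $\nu$ (viscosity) are real constants with $\mu,\ \lambda+\mu,\ \alpha,\ M,\ \kappa,\ \nu>0$. Put $\mathcal{V}=[H^1_0(\Omega)]^m$, $\mathcal{Q}=H^1_0(\Omega)$, $\varepsilon(u)=\frac12(\nabla u+(\nabla u)^* )$, $\sigma(u)=2\mu\,\varepsilon(u)+\lambda(\nabla\cdot u)\,\mathrm{id}$, and define $a(u,v)=\int_\Omega \sigma(u):\varepsilon(v)\,dx$, $b(p,q)=\int_\Omega\frac{\kappa}{\nu}\nabla p\cdot\nabla q\,dx$, $c(p,q)=\int_\Omega\frac1M p\,q\,dx$, $d(u,q)=\int_\Omega\alpha(\nabla\cdot u)\,q\,dx$ for $u,v\in\mathcal{V}$, $p,q\in\mathcal{Q}$. Coupling parameter: $\omega=\dfrac{\alpha^2M}{\mu+\lambda}$. Semi-discrete setting. A conforming discretization with finite-dimensional subspaces $V_h\subseteq\mathcal{V}$, $Q_h\subseteq\mathcal{Q}$ (dimensions $n_u$, $n_p$, with fixed bases) is used. $A\in\mathbb{R}^{n_u\times n_u}$, $B,C\in\mathbb{R}^{n_p\times n_p}$, $D\in\mathbb{R}^{n_p\times n_u}$ are the matrices representing $a,b,c,d$ on these spaces in the chosen bases (so $q^TDv$ represents $d(v,q)$ on coefficient vectors). $A,B,C$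 are symmetric positive definite and $D$ has full row rank. The right-hand sides are functions $f:[0,T]\to\mathbb{R}^{n_u}$, $g:[0,T]\to\mathbb{R}^{n_p}$. Notation. For a symmetric positive definite matrix $X$, $\|v\|_X^2=v^TXv$. The time grid is $t^n=n\tau$, $0\le n\le N$, $\tau=T/N$; $f^n=f(t^n)$, $g^n=g(t^n)$; $C_\tau=C+\tau B$. The term $\mathcal{O}(\tau)$ denotes a vector whose norm is bounded by a constant independent of $\tau$ times $\tau$. The scalar constant $\mathfrak{C}$ is not to be confused with the matrix $C$. The damped iterative scheme. Let $\gamma=2/(2+\omega)$ and let $K\in\mathbb{N}$, $K\ge1$, be fixed. Starting from $(u^0,p^0)$, for each $n=0,\dots,N-1$: set $u^{n+1}_0=u^n$, $p^{n+1}_0=p^n$. For $k=0,\dots,K-1$ define $\hat u^{n+1}_{k+1},\hat p^{n+1}_{k+1}$ by $A\hat u^{n+1}_{k+1}=f^{n+1}+D^Tp^{n+1}_k$, $C_\tau\hat p^{n+1}_{k+1}=\tau g^{n+1}+Du^n+Cp^n-D\hat u^{n+1}_{k+1}$; for $k=0,\dots,K-2$ set $u^{n+1}_{k+1}=\hat u^{n+1}_{k+1}$, $p^{n+1}_{k+1}=\gamma\hat p^{n+1}_{k+1}+(1-\gamma)p^{n+1}_k$; finally set $u^{n+1}=u^{n+1}_K=\hat u^{n+1}_K$, $p^{n+1}=p^{n+1}_K=\hat p^{n+1}_K$ (no damping in the last inner step). *)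

(* Defs.v *)
From HB Require Import structures.
From mathcomp Require Import all_boot all_order all_algebra.
From mathcomp Require Import all_classical all_reals all_analysis.
Set Warnings "-redundant-canonical-projection".
Set Implicit Arguments.
Unset Strict Implicit.
Unset Printing Implicit Defensive.
Import Order.TTheory GRing.Theory Num.Theory.
Import numFieldNormedType.Exports.
Local Open Scope classical_set_scope.
Local Open Scope ring_scope.

(* The sigma-algebra on R^n is generated by the coordinates, as the library does
   for tuples; this is the Borel sigma-algebra. *)
Section measurable_rV.
Context {R : realType} (n : nat).

Definition coord_rV (i : 'I_n) (x : 'rV[R]_n) : R := x ord0 i.

Let rV_set0 : g_sigma_preimage coord_rV set0.
Proof. exact: sigma_algebra0. Qed.

Let rV_setC A : g_sigma_preimage coord_rV A -> g_sigma_preimage coord_rV (~` A).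
Proof. exact: sigma_algebraC. Qed.

Let rV_bigcup (F : (set 'rV[R]_n)^nat) :
  (forall i, g_sigma_preimage coord_rV (F i)) ->
  g_sigma_preimage coord_rV (\bigcup_i (F i)).
Proof. exact: sigma_algebra_bigcup. Qed.

HB.instance Definition _ := @isMeasurable.Build default_measure_display
  'rV[R]_n (g_sigma_preimage coord_rV) rV_set0 rV_setC rV_bigcup.

End measurable_rV.

Lemma measurable_fun_rVP (R : realType) n d (T : measurableType d)
    (f : T -> 'rV[R]_n) :
  measurable_fun [set: T] f <->
  forall i, measurable_fun [set: T] (coord_rV i \o f).
Proof.
apply: (@iff_trans _ (g_sigma_preimage
    (fun i => @coord_rV R n i \o f) `<=` measurable)).
  rewrite g_sigma_preimage_comp; split=> [mf A [/= C preC <-]|prefS].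
    exact: mf.
  by move=> _ A mA; apply: prefS; exists A.
split=> [rVfS i|mf].
- move=> _ A mA.
  apply: rVfS; apply: sub_sigma_algebra.
  case: n i => [[] []//|n i] in f *.
  rewrite -bigcup_mkord_ord.
  exists i; first exact: ltn_ord.
  by exists A => //; rewrite inord_val.
- apply: smallest_sub; first exact: sigma_algebra_measurable.
  case: n => [|n] in f mf *; first by rewrite big_ord0.
  rewrite -bigcup_mkord_ord; apply: bigcup_sub => i Ii.
  by move=> A [B mB <-]; exact: mf.
Qed.

Lemma measurable_coord_rV (R : realType) n (i : 'I_n) :
  measurable_fun [set: 'rV[R]_n] (coord_rV i).
Proof. by have /measurable_fun_rVP := @measurable_id _ 'rV[R]_n setT; exact. Qed.

(* Lebesgue measure on R^n, by induction on n through R^n.+1 = R * R^n. *)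
Section lebesgue_rV.
Context {R : realType}.

Definition cons_rV n (x : measurableTypeR R * 'rV[R]_n) : 'rV[R]_n.+1 :=
  row_mx (x.1 : R)%:M x.2.

Definition behead_rV n (x : 'rV[R]_n.+1) : measurableTypeR R * 'rV[R]_n :=
  (x ord0 ord0, \row_j x ord0 (lift ord0 j)).

Lemma cons_rVK n : cancel (@cons_rV n) (@behead_rV n).
Proof.
case=> a y; rewrite /behead_rV /cons_rV /=; congr pair.
  by rewrite mxE; case: splitP => [j _|j /eqP//]; rewrite (ord1 j) mxE eqxx mulr1n.
apply/rowP => j; rewrite !mxE; case: splitP => [k /= /eqP|k /= /eqP].
  by rewrite ord1.
by rewrite eqSS => /eqP jk; congr (y _ _); exact: val_inj.
Qed.

Lemma behead_rVK n : cancel (@behead_rV n) (@cons_rV n).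
Proof.
move=> x; apply/rowP => j; rewrite /cons_rV /behead_rV !mxE /=.
case: splitP => k /= jk.
  by rewrite (ord1 k) mxE eqxx mulr1n; congr (x _ _); apply: val_inj; rewrite /= jk ord1.
by rewrite mxE; congr (x _ _); exact: val_inj.
Qed.

Lemma measurable_cons_rV n : measurable_fun [set: _] (@cons_rV n).
Proof.
apply/measurable_fun_rVP => i; have [->|i0] := eqVneq i ord0.
  rewrite (_ : _ \o _ = fst); first exact: measurable_fst.
  by apply/funext => x; have /(congr1 fst) := cons_rVK x.
have [j ->] : exists j, i = lift ord0 j.
  by case: (unliftP ord0 i) i0 => [j -> _|-> /eqP//]; exists j.
rewrite (_ : _ \o _ = coord_rV j \o snd).
  exact: (measurableT_comp (measurable_coord_rV j) measurable_snd).
apply/funext => x /=; have /(congr1 snd) /= <- := cons_rVK x.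
by rewrite /coord_rV mxE.
Qed.

Lemma measurable_behead_rV n : measurable_fun [set: _] (@behead_rV n).
Proof.
apply: measurable_fun_pair; first exact: (measurable_coord_rV ord0).
apply/measurable_fun_rVP => i.
rewrite (_ : _ \o _ = coord_rV (lift ord0 i)); first exact: measurable_coord_rV.
by apply/funext => x; rewrite /= /coord_rV mxE.
Qed.

Section step.
Variables (n : nat) (mu : {sigma_finite_measure set 'rV[R]_n -> \bar R}).

Definition lebesgue_rV_step : set 'rV[R]_n.+1 -> \bar R :=
  pushforward (lebesgue_measure \x mu)%E (@cons_rV n).

HB.instance Definition _ := Measure.copy lebesgue_rV_step
  (measure_function_pushforward__canonical__measure_function_Measure
     (lebesgue_measure \x mu)%E (@measurable_cons_rV n)).

Let lebesgue_rV_step_sigma_finite : sigma_finite setT lebesgue_rV_step.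
Proof.
have /sigma_finiteP[F [TF ndF Foo]] := sigma_finiteT (@lebesgue_measure R).
have /sigma_finiteP[G [TG ndG Goo]] := sigma_finiteT mu.
exists (fun k => @behead_rV n @^-1` (F k `*` G k)).
  rewrite -preimage_bigcup (_ : \bigcup_i _ = setT) ?preimage_setT//.
  rewrite -setXTT TF TG predeqE => -[x y]; split; first by move=> [k _ []]; split; exists k.
  move=> [/= [k _ Fkx] [l _ Gly]]; exists (maxn k l) => //; split.
  - by move: x Fkx; exact/subsetPset/ndF/leq_maxl.
  - by move: y Gly; exact/subsetPset/ndG/leq_maxr.
move=> k; have [mF Fk] := Foo k; have [mG Gk] := Goo k; split.
  by rewrite -[X in measurable X]setTI; apply: measurable_behead_rV => //; exact: measurableX.
rewrite /lebesgue_rV_step /pushforward -comp_preimage.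
rewrite (_ : _ \o _ = id) ?preimage_id; last by apply/funext => x; exact: cons_rVK.
by rewrite product_measure1E// lte_mul_pinfty// ge0_fin_numE.
Qed.

HB.instance Definition _ := Measure_isSigmaFinite.Build _ _ _ lebesgue_rV_step
  lebesgue_rV_step_sigma_finite.

End step.

Fixpoint lebesgue_rV n : {sigma_finite_measure set 'rV[R]_n -> \bar R} :=
  match n with
  | 0 => \d_(0 : 'rV[R]_0)
  | n.+1 => lebesgue_rV_step (lebesgue_rV n)
  end.

End lebesgue_rV.

Section domain.
Context {R : realType} (m : nat).
Implicit Type Om : set 'rV[R]_m.

(* Near every boundary point, in some orthonormal coordinates, Om is the part
   above the graph of a Lipschitz function of the m - 1 other coordinates. *)
Definition lipschitz_boundary Om := forall x, (closure Om `\` Om) x ->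
  exists (Q : 'M[R]_m) (i : 'I_m) (h : 'rV[R]_m.-1 -> R) (r : R),
    [/\ Q *m Q^T = 1%:M, lipschitz (h : _ -> R^o), 0 < r
      & forall y, ball x r y ->
          (Om y <-> h (col' i (y *m Q)) < (y *m Q) ord0 i)].

Definition bounded_lipschitz_domain Om :=
  [/\ open Om, connected Om, Om !=set0, bounded_set Om & lipschitz_boundary Om].

End domain.

Section sobolev.
Context {R : realType} (m : nat) (Om : set 'rV[R]_m).
Implicit Types v g phi : 'rV[R]_m -> R.
Local Notation leb := (@lebesgue_rV R m).

Definition partial (i : 'I_m) v : 'rV[R]_m -> R := 'D_(delta_mx ord0 i) v.

Definition smooth v := forall s : seq 'I_m,
  let w := foldr partial v s in
  continuous w /\ forall i x, derivable w x (delta_mx ord0 i).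

Definition test_function phi := smooth phi /\
  exists2 K, compact K & K `<=` Om /\ forall x, ~ K x -> phi x = 0.

Definition L2 v := measurable_fun Om v /\
  leb.-integrable Om (fun x => (v x ^+ 2)%:E).

Definition is_weak_partial (i : 'I_m) v g := L2 g /\
  forall phi, test_function phi ->
    \int[leb]_(x in Om) (v x * partial i phi x) =
    - \int[leb]_(x in Om) (g x * phi x).

(* A representative; it is determined almost everywhere on Om. *)
Definition weak_partial (i : 'I_m) v : 'rV[R]_m -> R :=
  xget (fun=> 0) (is_weak_partial i v).

Definition H1 v := L2 v /\ forall i, exists g, is_weak_partial i v g.

(* H^1_0 is the closure of the test functions in H^1. *)
Definition H10 v := H1 v /\ exists phi : nat -> 'rV[R]_m -> R,
  [/\ forall k, test_function (phi k),
      (\int[leb]_(x in Om) ((phi k x - v x) ^+ 2)%:E)%E @[k --> \oo] --> 0%E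
    & forall i, (\int[leb]_(x in Om)
        ((partial i (phi k) x - weak_partial i v x) ^+ 2)%:E)%E
          @[k --> \oo] --> 0%E].

Definition component (u : 'rV[R]_m -> 'rV[R]_m) (j : 'I_m) : 'rV[R]_m -> R :=
  fun x => u x ord0 j.

Definition H10v (u : 'rV[R]_m -> 'rV[R]_m) := forall j, H10 (component u j).

Definition lin_indep (V : lmodType R) n (b : 'I_n -> 'rV[R]_m -> V) :=
  forall c : 'I_n -> R,
    {ae leb, forall x, Om x -> \sum_i c i *: b i x = 0} -> forall i, c i = 0.

End sobolev.

Section forms.
Context {R : realType} (m : nat) (Om : set 'rV[R]_m).
Implicit Types (u v : 'rV[R]_m -> 'rV[R]_m) (p q : 'rV[R]_m -> R).
Local Notation leb := (@lebesgue_rV R m).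

Definition divergence u x := \sum_j weak_partial Om j (component u j) x.

Definition strain u x : 'M[R]_m := \matrix_(i, j)
  (2^-1 * (weak_partial Om i (component u j) x + weak_partial Om j (component u i) x)).

Definition stress (mu lambda : R) u x : 'M[R]_m :=
  (2 * mu) *: strain u x + (lambda * divergence u x)%:M.

Definition form_a (mu lambda : R) u v : R := \int[leb]_(x in Om)
  (\sum_i \sum_j stress mu lambda u x i j * strain v x i j).

Definition form_b (kappa nu : R) p q : R := \int[leb]_(x in Om)
  (kappa / nu * \sum_i weak_partial Om i p x * weak_partial Om i q x).

Definition form_c (M : R) p q : R := \int[leb]_(x in Om) (M^-1 * p x * q x).

Definition form_d (alpha : R) u q : R := \int[leb]_(x in Om)
  (alpha * divergence u x * q x).

(* w^T X v = form (\sum_j v_j bc_j) (\sum_i w_i br_i) for X = form_mx form bc br. *)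
Definition form_mx (U W : Type) (form : U -> W -> R) n k
    (bc : 'I_n -> U) (br : 'I_k -> W) : 'M[R]_(k, n) :=
  \matrix_(i, j) form (bc j) (br i).

End forms.

Section matrices.
Context {R : realType} (n : nat).

Definition sqnorm (X : 'M[R]_n) (v : 'cV[R]_n) : R := (v^T *m X *m v) ord0 ord0.

Definition spd (X : 'M[R]_n) := X^T = X /\ forall v, v != 0 -> 0 < sqnorm X v.

End matrices.

(* Derivatives on a set I of times, one-sided at the endpoints of an interval. *)
Section time_derivative.
Context {R : realType} {V : normedModType R} (I : set R).

Definition diff_quot (y : R -> V) (t s : R) : V := (s - t)^-1 *: (y s - y t).

Definition derivable_on (y : R -> V) :=
  forall t, I t -> cvg (diff_quot y t s @[s --> within I t^']).

Definition derive_on (y : R -> V) (t : R) : V :=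
  lim (diff_quot y t s @[s --> within I t^']).

Fixpoint Ck (k : nat) (y : R -> V) : Prop :=
  match k with
  | 0 => {within I, continuous y}
  | k'.+1 => derivable_on y /\ Ck k' (derive_on y)
  end.

Definition Ck_bounded (k : nat) (L : R) (y : R -> V) :=
  forall j t, (j <= k)%N -> I t -> `|iter j derive_on y t| <= L.

End time_derivative.

Section poroelasticity.
Context {R : realType} (n_u n_p : nat).
Variables (A : 'M[R]_n_u) (B C : 'M[R]_n_p) (D : 'M[R]_(n_p, n_u)).
Variables (f : R -> 'cV[R]_n_u) (g : R -> 'cV[R]_n_p).

Definition semi_discrete_solution (I : set R) (u0 : 'cV[R]_n_u) (p0 : 'cV[R]_n_p)
    (u : R -> 'cV[R]_n_u) (p : R -> 'cV[R]_n_p) :=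
  [/\ forall t, I t -> A *m u t - D^T *m p t = f t,
      forall t, I t ->
        D *m derive_on I u t + C *m derive_on I p t + B *m p t = g t,
      u 0 = u0 & p 0 = p0].

(* uh n k, ph n k, uk n k, pk n k stand for \hat u^{n+1}_k, \hat p^{n+1}_k,
   u^{n+1}_k, p^{n+1}_k. *)
Definition damped_scheme (tau gamma : R) (K N : nat)
    (u0 : 'cV[R]_n_u) (p0 : 'cV[R]_n_p)
    (u : nat -> 'cV[R]_n_u) (p : nat -> 'cV[R]_n_p) :=
  [/\ u 0%N = u0, p 0%N = p0
    & exists (uh uk : nat -> nat -> 'cV[R]_n_u)
             (ph pk : nat -> nat -> 'cV[R]_n_p),
      forall n, (n < N)%N ->
      [/\ uk n 0%N = u n /\ pk n 0%N = p n,
          forall k, (k < K)%N ->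
            A *m uh n k.+1 = f (n.+1%:R * tau) + D^T *m pk n k /\
            (C + tau *: B) *m ph n k.+1 =
              tau *: g (n.+1%:R * tau) + D *m u n + C *m p n - D *m uh n k.+1,
          forall k, (k.+1 < K)%N ->
            uk n k.+1 = uh n k.+1 /\
            pk n k.+1 = gamma *: ph n k.+1 + (1 - gamma) *: pk n k,
          u n.+1 = uk n K /\ uk n K = uh n K
        & p n.+1 = pk n K /\ pk n K = ph n K]].

End poroelasticity.

(* Main.v *)
Require Import Defs.
From mathcomp Require Import all_boot all_order all_algebra.
From mathcomp Require Import all_classical all_reals all_analysis.
From mathcomp Require Import measurable_realfun ring lra.
Set Implicit Arguments.
Unset Strict Implicit.
Unset Printing Implicit Defensive.
Import Order.TTheory GRing.Theory Num.Theory.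
Import numFieldNormedType.Exports.
Local Open Scope classical_set_scope.
Local Open Scope ring_scope.

(** The argument separates the elliptic content of the problem from the time
    stepping.

    Write X = C + tau B and S = D A^-1 D^T. The inner iteration of one time step has
    a fixed point, the pressure of the implicit Euler step. If y is the distance of
    a pressure iterate to that fixed point, the next undamped iterate has the
    distance y' with X y' = - S y. Since S is symmetric and 0 <= S <= omega C <=
    omega X, the map from y to y' is X-selfadjoint with spectrum in [-omega, 0], so it
    has norm at most omega, and the damping gamma = 2 / (2 + omega) centres this
    spectrum and lowers the norm to omega / (2 + omega) ([enorm_solve_le],
    [enorm_damped_le]). As K - 1 damped iterations are followed by an undamped one, a
    time step contracts the distance by
    rho = omega^K / (2 + omega)^(K - 1) < 1.

    The bound S <= omega C is a statement on the continuous forms: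
    d(u,q)^2 <= omega a(u,u) c(q,q) ([coupling_bound]), which by Cauchy-Schwarz follows
    from (mu + lambda) |div u|^2 <= a(u,u) ([div_le_elastic_energy]). In three
    dimensions this fails pointwise; it needs the identity
      int d_i u_j d_j u_i = int d_i u_i d_j u_j   on H^1_0,
    which follows from the symmetry of second derivatives of test functions
    ([partialC]) and density ([L2dot_weak_partial_swap]).

    For the time stepping let e be the pressure error at a grid point, eta = D times the
    displacement error, z = (X + S)^-1 (X e + eta) and h = e - z. Then z is the error of
    the fixed point of the inner iteration and h the distance of the computed pressure
    to it. As the last inner step is not damped, X p + D u obeys the implicit Euler
    recursion exactly whatever the inner error is, so that
    (X + S) (z' - z) = - tau B e + O(tau^2): z grows like the error of implicit Euler.
    The start value of the inner iteration is off by the increment of the solution,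
    which is O(tau) and not O(tau^2), but it enters h only and is multiplied by rho at
    each step, so that these contributions form a geometric series instead of
    accumulating. The two recursions are combined in [coupled_recursion]. All norms are
    X-norms of the current tau; they compare with norms independent of tau because
    C <= X <= C + T B. *)

(** * Positive semidefinite forms on coefficient vectors *)

Lemma discriminant_le (R : realFieldType) (a b c : R) :
  (forall t, 0 <= a + 2 * t * b + t ^+ 2 * c) -> b ^+ 2 <= a * c.
Proof.
move=> h.
have a0 : 0 <= a by have := h 0; rewrite expr2; lra.
have [c0|c0|c0] := ltgtP c 0.
- exfalso; set t := (a + 1) / - c + 1; have := h t; have := h (- t).
  (* for c < 0 the quadratic is negative far away on one side *)
  have tc : t * c = - (a + 1) + c.
    by rewrite /t mulrDl mul1r invrN mulrN mulNr divfK// lt_eqF.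
  have t1 : 1 <= t by rewrite lerDr divr_ge0//; lra.
  have tc2 : t ^+ 2 * c = t * (- (a + 1) + c) by rewrite -tc expr2 mulrA.
  rewrite sqrrN tc2; nra.
- have := h (- (b / c)); set t := b / c.
  have tc : t * c = b by rewrite /t divfK// gt_eqF.
  nra.
- rewrite c0 mulr0; have [->|b0] := eqVneq b 0; first by rewrite expr2 mul0r.
  exfalso; have := h (- ((a + 1) / (2 * b))); set t := _ / _.
  have tb : t * (2 * b) = a + 1 by rewrite /t divfK// mulf_neq0// pnatr_eq0.
  nra.
Qed.

Section dot.
Context {R : realType}.
Implicit Types n : nat.

Definition dotv n (x y : 'cV[R]_n) : R := (x^T *m y) ord0 ord0.

Lemma dotvE n (x y : 'cV[R]_n) : dotv x y = \sum_i x i ord0 * y i ord0.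
Proof. by rewrite /dotv mxE; apply: eq_bigr => i _; rewrite mxE. Qed.

Lemma dotvC n (x y : 'cV[R]_n) : dotv x y = dotv y x.
Proof. by rewrite !dotvE; apply: eq_bigr => i _; rewrite mulrC. Qed.

Lemma dotvDr n (x y z : 'cV[R]_n) : dotv x (y + z) = dotv x y + dotv x z.
Proof. by rewrite /dotv mulmxDr mxE. Qed.

Lemma dotvDl n (x y z : 'cV[R]_n) : dotv (x + y) z = dotv x z + dotv y z.
Proof. by rewrite dotvC dotvDr !(dotvC z). Qed.

Lemma dotvZr n k (x y : 'cV[R]_n) : dotv x (k *: y) = k * dotv x y.
Proof. by rewrite /dotv -scalemxAr mxE. Qed.

Lemma dotvZl n k (x y : 'cV[R]_n) : dotv (k *: x) y = k * dotv x y.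
Proof. by rewrite dotvC dotvZr dotvC. Qed.

Lemma dotvNr n (x y : 'cV[R]_n) : dotv x (- y) = - dotv x y.
Proof. by rewrite -scaleN1r dotvZr mulN1r. Qed.

Lemma dotv_mul n m (F : 'M[R]_(n, m)) x y :
  dotv x (F *m y) = dotv (F^T *m x) y.
Proof. by rewrite /dotv trmx_mul trmxK mulmxA. Qed.

Lemma sqnormE n (X : 'M[R]_n) v : sqnorm X v = dotv v (X *m v).
Proof. by rewrite /sqnorm /dotv mulmxA. Qed.

Definition psd n (X : 'M[R]_n) := X^T = X /\ forall v, 0 <= sqnorm X v.

Lemma sqnorm0 n (X : 'M[R]_n) : sqnorm X 0 = 0.
Proof. by rewrite /sqnorm mulmx0 mxE. Qed.

Lemma spd_psd n (X : 'M[R]_n) : spd X -> psd X.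
Proof.
move=> [XT X0]; split=> // v; have [->|v0] := eqVneq v 0; last exact/ltW/X0.
by rewrite sqnorm0.
Qed.

Lemma spd_unitmx n (X : 'M[R]_n) : spd X -> X \in unitmx.
Proof.
move=> [XT X0]; rewrite -row_free_unit -kermx_eq0; apply/eqP/row_matrixP => i.
rewrite row0; apply/eqP/negPn/negP => r0.
have := X0 (row i (kermx X))^T; rewrite /sqnorm trmxK.
rewrite (_ : row i (kermx X) *m X = 0).
  by rewrite mul0mx mxE ltxx trmx_eq0 => /(_ r0).
by apply/sub_kermxP; exact: row_sub.
Qed.

Lemma spdD n (X Y : 'M[R]_n) : spd X -> psd Y -> spd (X + Y).
Proof.
move=> [XT X0] [YT Y0]; split; first by rewrite linearD /= XT YT.
move=> v v0; rewrite sqnormE mulmxDl dotvDr -!sqnormE.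
by rewrite ltr_wpDr// X0.
Qed.

Lemma psdZ n k (X : 'M[R]_n) : 0 <= k -> psd X -> psd (k *: X).
Proof.
move=> k0 [XT X0]; split; first by rewrite linearZ /= XT.
by move=> v; rewrite sqnormE -scalemxAl dotvZr -sqnormE mulr_ge0.
Qed.

(** The expansion behind both Cauchy-Schwarz and the contraction estimates. *)
Lemma sqnormDscale n (X : 'M[R]_n) t x y : X^T = X ->
  sqnorm X (x + t *: y) =
  sqnorm X x + 2 * t * dotv x (X *m y) + t ^+ 2 * sqnorm X y.
Proof.
move=> XT; rewrite !sqnormE mulmxDr -!scalemxAr !(dotvDl, dotvDr, dotvZl, dotvZr).
rewrite [dotv y (X *m x)]dotv_mul XT (dotvC (X *m y)).
by ring.
Qed.

Lemma psd_cauchy_schwarz n (X : 'M[R]_n) x y : psd X ->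
  dotv x (X *m y) ^+ 2 <= sqnorm X x * sqnorm X y.
Proof.
move=> [XT X0]; apply: discriminant_le => t.
by rewrite -sqnormDscale.
Qed.

(** The energy norm of X, only a seminorm when X is semidefinite. *)
Definition enorm n (X : 'M[R]_n) v := Num.sqrt (sqnorm X v).

Lemma enorm_ge0 n (X : 'M[R]_n) v : 0 <= enorm X v.
Proof. exact: sqrtr_ge0. Qed.
#[local] Hint Resolve enorm_ge0 : core.

Lemma sqr_enorm n (X : 'M[R]_n) v : psd X -> enorm X v ^+ 2 = sqnorm X v.
Proof. by move=> [_ X0]; rewrite sqr_sqrtr. Qed.

Lemma dotv_le_enorm n (X : 'M[R]_n) x y : psd X ->
  `|dotv x (X *m y)| <= enorm X x * enorm X y.
Proof.
move=> pX; rewrite -(@ler_pXn2r _ 2)// ?nnegrE ?mulr_ge0//.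
rewrite exprMn !sqr_enorm// real_normK ?num_real//.
exact: psd_cauchy_schwarz.
Qed.

Lemma enorm0 n (X : 'M[R]_n) : enorm X 0 = 0.
Proof. by rewrite /enorm sqnorm0 sqrtr0. Qed.

Lemma enormZ n (X : 'M[R]_n) k v : enorm X (k *: v) = `|k| * enorm X v.
Proof.
rewrite /enorm sqnormE -scalemxAr dotvZl dotvZr -sqnormE mulrA -expr2.
by rewrite sqrtrM ?sqr_ge0// sqrtr_sqr.
Qed.

Lemma enormN n (X : 'M[R]_n) v : enorm X (- v) = enorm X v.
Proof. by rewrite -scaleN1r enormZ normrN1 mul1r. Qed.

Lemma enormD n (X : 'M[R]_n) x y : psd X ->
  enorm X (x + y) <= enorm X x + enorm X y.
Proof.
move=> pX; rewrite -(@ler_pXn2r _ 2)// ?nnegrE ?addr_ge0//.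
have [XT _] := pX.
rewrite sqr_enorm// -[y in x + y]scale1r sqnormDscale//.
rewrite -!sqr_enorm//; have := dotv_le_enorm x y pX.
have := ler_norm (dotv x (X *m y)).
by rewrite !expr2; nra.
Qed.

Lemma enorm_mono n (X Y : 'M[R]_n) v :
  sqnorm X v <= sqnorm Y v -> enorm X v <= enorm Y v.
Proof. by move=> h; rewrite ler_wsqrtr. Qed.

End dot.
#[global] Hint Extern 0 (is_true (_ <= enorm _ _)) => exact: enorm_ge0 : core.

Section finite_dim.
Context {R : realType}.

Lemma normv_bound n (x : 'cV[R]_n) (e : R) : 0 <= e ->
  (forall i, `|x i ord0| <= e) -> `|x| <= e.
Proof.
move=> e0 h; rewrite [leLHS]/Num.Def.normr/= mx_normrE bigmax_le//= => -[i j] _ /=.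
by rewrite ord1.
Qed.

Lemma coord_le_normv n (x : 'cV[R]_n) i : `|x i ord0| <= `|x|.
Proof.
rewrite [leRHS]/Num.Def.normr/= mx_normrE.
by apply: le_trans (le_bigmax _ _ (i, ord0)).
Qed.

Lemma norm_mulmx_le n m (F : 'M[R]_(n, m)) :
  exists2 c : R, 0 <= c & forall x : 'cV[R]_m, `|F *m x| <= c * `|x|.
Proof.
exists (\sum_i \sum_j `|F i j|).
  by apply: sumr_ge0 => i _; apply: sumr_ge0.
move=> x; apply: normv_bound; first by rewrite mulr_ge0// !sumr_ge0// => i _; rewrite sumr_ge0.
move=> i; rewrite mxE (le_trans (ler_norm_sum _ _ _))//.
rewrite (@le_trans _ _ ((\sum_j `|F i j|) * `|x|))//.
  rewrite mulr_suml; apply: ler_sum => j _.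
  by rewrite normrM ler_wpM2l// coord_le_normv.
rewrite ler_wpM2r// [leRHS](bigD1 i)//= lerDl.
by apply: sumr_ge0 => k _; apply: sumr_ge0.
Qed.

Lemma dotv_le_norm n (x y : 'cV[R]_n) : `|dotv x y| <= n%:R * `|x| * `|y|.
Proof.
rewrite dotvE (le_trans (ler_norm_sum _ _ _))//.
rewrite (@le_trans _ _ (\sum_(i < n) `|x| * `|y|))//.
  by apply: ler_sum => i _; rewrite normrM ler_pM// coord_le_normv.
by rewrite sumr_const card_ord -mulrA mulr_natl.
Qed.

(** The coordinate v_i is the X-product of v with X^-1 e_i, so Cauchy-Schwarz gives
    the constant without a compactness argument. *)
Lemma norm_le_enorm n (X : 'M[R]_n) : spd X ->
  exists2 c : R, 0 <= c & forall v, `|v| <= c * enorm X v.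
Proof.
move=> sX; pose w i : 'cV[R]_n := invmx X *m delta_mx i ord0.
exists (\sum_i enorm X (w i)); first by apply: sumr_ge0 => i _; exact: enorm_ge0.
move=> v; apply: normv_bound; first by apply: mulr_ge0; [apply: sumr_ge0 => i _|]; exact: enorm_ge0.
move=> i; have -> : v i ord0 = dotv v (X *m w i).
  rewrite /w mulmxA mulmxV ?mul1mx ?spd_unitmx// dotvC dotvE (bigD1 i)//=.
  by rewrite !mxE !eqxx mul1r big1 ?addr0// => j ji; rewrite !mxE (negPf ji) mul0r.
rewrite (le_trans (dotv_le_enorm _ _ (spd_psd sX)))// mulrC ler_wpM2r//.
by rewrite [leRHS](bigD1 i)//= lerDl sumr_ge0.
Qed.

Lemma enorm_le_enorm n (X Y : 'M[R]_n) : spd X -> psd Y ->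
  exists2 b : R, 0 <= b & forall v, enorm Y v <= b * enorm X v.
Proof.
move=> sX pY; have [c c0 hc] := norm_le_enorm sX.
have [d d0 hd] := norm_mulmx_le Y.
have k0 : 0 <= n%:R * d * c ^+ 2 by rewrite !mulr_ge0 ?exprn_ge0.
exists (Num.sqrt (n%:R * d * c ^+ 2)); first exact: sqrtr_ge0.
move=> v; rewrite -(@ler_pXn2r _ 2)// ?nnegrE ?mulr_ge0// ?sqrtr_ge0//.
rewrite sqr_enorm// exprMn sqr_sqrtr// sqnormE.
rewrite (le_trans (ler_norm _))// (le_trans (dotv_le_norm _ _))//.
rewrite (@le_trans _ _ (n%:R * `|v| * (d * `|v|)))//.
  by rewrite ler_wpM2l ?mulr_ge0.
rewrite (_ : n%:R * `|v| * (d * `|v|) = n%:R * d * `|v| ^+ 2); last by ring.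
rewrite -[leRHS]mulrA -exprMn ler_wpM2l ?mulr_ge0//.
by rewrite ler_pXn2r// nnegrE ?mulr_ge0.
Qed.

Lemma enorm_le_norm n (X : 'M[R]_n) : psd X ->
  exists2 k : R, 0 <= k & forall v, enorm X v <= k * `|v|.
Proof.
move=> pX; have [d d0 hd] := norm_mulmx_le X.
exists (Num.sqrt (n%:R * d)); first exact: sqrtr_ge0.
move=> v; rewrite -(@ler_pXn2r _ 2)// ?nnegrE ?mulr_ge0 ?sqrtr_ge0//.
rewrite sqr_enorm// exprMn sqr_sqrtr ?mulr_ge0// sqnormE.
rewrite (le_trans (ler_norm _))// (le_trans (dotv_le_norm _ _))//.
rewrite (_ : n%:R * d * `|v| ^+ 2 = n%:R * `|v| * (d * `|v|)); last by ring.
by rewrite ler_wpM2l ?mulr_ge0.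
Qed.

End finite_dim.

Section contraction.
Context {R : realType} (n : nat) (X S : 'M[R]_n) (w : R).
Hypotheses (pX : psd X) (pS : psd S) (w0 : 0 < w).
Hypothesis SX : forall v, sqnorm S v <= w * sqnorm X v.

(** Semidefiniteness of S at y + y' / omega, where <y, S y'> = - |y'|_X^2, replaces
    the spectral theorem for the X-selfadjoint map X^-1 S. *)
Lemma sqnorm_solve_le y y' : X *m y' = - (S *m y) ->
  sqnorm X y' <= w * sqnorm S y.
Proof.
move=> yy'; have [ST S0] := pS.
have := S0 (y + w^-1 *: y'); rewrite sqnormDscale//.
have -> : dotv y (S *m y') = - sqnorm X y'.
  by rewrite sqnormE yy' dotvNr opprK dotv_mul ST dotvC.
have := SX y'; set a := sqnorm S y; set b := sqnorm X y'; set c := sqnorm S y'.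
move=> cb h; have wV : w * w^-1 = 1 by rewrite divff// gt_eqF.
have wV0 : 0 < w^-1 by rewrite invr_gt0.
have : w^-1 ^+ 2 * c <= w^-1 * b.
  rewrite expr2 -mulrA ler_wpM2l ?(ltW wV0)//.
  by rewrite -(ler_pM2l w0) mulrA wV mul1r.
move=> h2; have : 0 <= w * (a + 2 * w^-1 * - b + w^-1 * b).
  by apply: mulr_ge0; [exact: ltW|lra].
have -> : w * (a + 2 * w^-1 * - b + w^-1 * b) = w * a - (w * w^-1) * b by ring.
by rewrite wV; lra.
Qed.

Lemma enorm_solve_le y y' : X *m y' = - (S *m y) ->
  enorm X y' <= w * enorm X y.
Proof.
move=> yy'; rewrite -(@ler_pXn2r _ 2)// ?nnegrE ?mulr_ge0 ?(ltW w0)//.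
rewrite exprMn !sqr_enorm//; apply: le_trans (sqnorm_solve_le yy') _.
by rewrite expr2 -mulrA ler_wpM2l ?(ltW w0).
Qed.

(** The damped iterate is (omega y + 2 y') / (2 + omega); in the square of its norm the
    cross term 4 omega <y, X y'> = - 4 omega |y|_S^2 outweighs 4 |y'|_X^2, so the norm
    of omega y + 2 y' is at most that of omega y. *)
Lemma enorm_damped_le y y' : X *m y' = - (S *m y) ->
  enorm X (2 / (2 + w) *: y' + (1 - 2 / (2 + w)) *: y) <= w / (2 + w) * enorm X y.
Proof.
move=> yy'; have w2 : 2 + w != 0 by rewrite gt_eqF// addr_gt0.
have -> : 2 / (2 + w) *: y' + (1 - 2 / (2 + w)) *: y
        = (2 + w)^-1 *: (w *: y + 2 *: y').
  rewrite scalerDr !scalerA addrC; congr (_ *: _ + _ *: _); first by field.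
  by rewrite mulrC.
rewrite enormZ ger0_norm ?invr_ge0 ?addr_ge0 ?(ltW w0)//.
rewrite [w / _]mulrC -mulrA ler_wpM2l ?invr_ge0 ?addr_ge0 ?(ltW w0)//.
rewrite -(@ler_pXn2r _ 2)// ?nnegrE ?mulr_ge0 ?(ltW w0)//.
have [XT _] := pX; have [ST _] := pS.
rewrite exprMn !sqr_enorm// sqnormDscale//.
have -> : sqnorm X (w *: y) = w ^+ 2 * sqnorm X y.
  by rewrite !sqnormE -scalemxAr dotvZl dotvZr; ring.
rewrite dotvZl yy' dotvNr -sqnormE.
have := sqnorm_solve_le yy'; set a := sqnorm S y; set b := sqnorm X y'.
by move=> h; rewrite !expr2; lra.
Qed.

End contraction.

(** * A discrete Gronwall argument *)

(** Here a stands for the error of the inner fixed point and b for the distance to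
    it. The weight th in V = a + th tau b is chosen so that the term be tau b, which a
    receives at each step, is paid for by the contraction of th tau b; V is then
    O(tau) by Gronwall. This only yields b = O(1), but fed back into the recursion of
    b it leaves a perturbation of size O(tau) per step, hence b = O(tau) by the
    geometric series. No smallness of tau is involved. *)
Lemma coupled_recursion (R : realType) (T rho be c1 c2 : R) :
  0 < T -> 0 <= rho < 1 -> 0 < be -> 0 <= c1 -> 0 <= c2 ->
  exists2 Cst : R, 0 <= Cst & forall (tau : R) (N : nat) (a b : nat -> R),
    0 < tau -> N%:R * tau = T -> a 0%N = 0 -> b 0%N = 0 ->
    (forall n, 0 <= a n) -> (forall n, 0 <= b n) ->
    (forall n, (n < N)%N ->
      a n.+1 <= a n + (be * tau * (a n + b n) + c1 * tau ^+ 2)) ->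
    (forall n, (n < N)%N ->
      b n.+1 <= rho * (b n + (be * tau * (a n + b n) + c1 * tau ^+ 2) + c2 * tau)) ->
    forall n, (n <= N)%N -> a n <= Cst * tau /\ b n <= Cst * tau.
Proof.
move=> T0 /andP[rho0 rho1] be0 c10 c20.
have r0 : 0 < 1 - rho by rewrite subr_gt0.
have [th th0 thE] : exists2 th, 0 < th & be + th * rho = th.
  exists (be / (1 - rho)); first exact: divr_gt0.
  by field; rewrite gt_eqF.
have [ka kaE] : exists ka, ka = be * (1 + th * T) by eexists.
have ka0 : 0 < ka by rewrite kaE mulr_gt0// addr_gt0// mulr_gt0.
have [c3 c3E] : exists c3, c3 = c1 + th * (c1 * T + c2) by eexists.
have c30 : 0 <= c3.
  by rewrite c3E addr_ge0// mulr_ge0 ?(ltW th0)// addr_ge0// mulr_ge0 ?(ltW T0).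
have [c4 c4E] : exists c4, c4 = T * c3 * expR (ka * T) by eexists.
have c40 : 0 <= c4 by rewrite c4E !mulr_ge0 ?(ltW T0) ?expR_ge0.
have [c6 c6E] : exists c6, c6 = be * (c4 * T + c4 / th) + c1 * T by eexists.
have c60 : 0 <= c6.
  rewrite c6E; apply: addr_ge0; apply: mulr_ge0 => //; try exact: ltW.
  apply: addr_ge0; first by apply: mulr_ge0 => //; exact: ltW.
  by apply: divr_ge0 => //; exact: ltW.
have [c7 c70 c7E] : exists2 c7, 0 <= c7 & c7 * (1 - rho) = c6 + c2.
  exists ((c6 + c2) / (1 - rho)); last by rewrite divfK// gt_eqF.
  by apply: divr_ge0; [exact: addr_ge0|exact: ltW].
(* c4 bounds V / tau, c4 / th bounds b, c6 tau bounds the increment of a *)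
exists (c4 + c7); first by rewrite addr_ge0.
move=> tau N a b tau0 NT a0 b0 age bge aS bS.
have tauT : (0 < N)%N -> tau <= T.
  by move=> N0; rewrite -NT ler_peMl ?(ltW tau0)// ler1n.
pose V n := a n + th * tau * b n.
have Vge n : 0 <= V n by rewrite addr_ge0// !mulr_ge0 ?(ltW th0) ?(ltW tau0).
have VS n : (n < N)%N -> V n.+1 <= (1 + ka * tau) * V n + c3 * tau ^+ 2.
  move=> nN; have tT := tauT (leq_ltn_trans (leq0n _) nN).
  have := aS n nN; have := bS n nN; set de := be * tau * _ + _ => hb ha.
  have de0 : 0 <= de.
    by rewrite addr_ge0 ?mulr_ge0 ?addr_ge0 ?(ltW be0) ?(ltW tau0).
  have hb' : b n.+1 <= rho * b n + de + c2 * tau.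
    apply: le_trans hb _.
    have -> : rho * (b n + de + c2 * tau) = rho * b n + rho * (de + c2 * tau) by ring.
    rewrite -[leRHS]addrA lerD2l.
    by rewrite ler_piMl ?(ltW rho1)// addr_ge0// mulr_ge0 ?(ltW tau0).
  have tt0 : 0 <= th * tau by rewrite mulr_ge0 ?(ltW th0) ?(ltW tau0).
  have hV : V n.+1 <= a n + de + th * tau * (rho * b n + de + c2 * tau).
    by rewrite lerD// ler_wpM2l.
  apply: le_trans hV _.
  have tde : th * tau * de <= th * T * (be * tau * a n) + be * tau * (th * tau * b n)
       + th * c1 * T * tau ^+ 2
       + be * th * T * tau * (th * tau * b n).
    have -> : th * tau * de = th * tau * (be * tau * a n) + be * tau * (th * tau * b n)
       + th * c1 * tau * tau ^+ 2 by rewrite /de; ring.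
    have h1 : th * tau * (be * tau * a n) <= th * T * (be * tau * a n).
      by rewrite ler_wpM2r ?mulr_ge0 ?(ltW be0) ?(ltW tau0)// ler_wpM2l ?(ltW th0).
    have h2 : th * c1 * tau * tau ^+ 2 <= th * c1 * T * tau ^+ 2.
      by rewrite ler_wpM2r ?exprn_ge0 ?(ltW tau0)// ler_wpM2l ?mulr_ge0 ?(ltW th0).
    have h3 : 0 <= be * th * T * tau * (th * tau * b n).
      by rewrite !mulr_ge0 ?(ltW be0) ?(ltW tau0) ?(ltW T0) ?(ltW th0).
    by lra.
  have -> : a n + de + th * tau * (rho * b n + de + c2 * tau)
      = a n + be * tau * a n + tau * (be + th * rho) * b n + c1 * tau ^+ 2
        + th * tau * de + th * c2 * tau ^+ 2 by rewrite /de; ring.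
  rewrite thE; apply: le_trans (_ : a n + be * tau * a n + tau * th * b n + c1 * tau ^+ 2
     + (th * T * (be * tau * a n) + be * tau * (th * tau * b n)
       + th * c1 * T * tau ^+ 2 + be * th * T * tau * (th * tau * b n))
     + th * c2 * tau ^+ 2 <= _); first by lra.
  by rewrite le_eqVlt; apply/orP; left; apply/eqP; rewrite /V kaE c3E; ring.
have Vb n : (n <= N)%N -> V n <= n%:R * tau * (c3 * tau) * expR (ka * (n%:R * tau)).
  elim: n => [_|n IH nN].
    by rewrite /V a0 b0 mulr0 addr0 !mul0r.
  apply: le_trans (VS n nN) _; have := IH (ltnW nN) => {}IH.
  set E := expR _ in IH; have E1 : 1 <= E.
    by rewrite /E -expR0 ler_expR !mulr_ge0 ?(ltW ka0) ?(ltW tau0).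
  have -> : expR (ka * (n.+1%:R * tau)) = expR (ka * tau) * E.
    by rewrite /E -expRD -natr1; congr expR; ring.
  have kt0 : 0 <= ka * tau by rewrite mulr_ge0 ?(ltW ka0) ?(ltW tau0).
  have e1 : 1 + ka * tau <= expR (ka * tau) by exact: expR_ge1Dx.
  set F := expR (ka * tau) in e1 *.
  set q := c3 * tau in IH *; have q0 : 0 <= q by rewrite mulr_ge0 ?(ltW tau0).
  have m0 : 0 <= n%:R * tau * q * E.
    by rewrite !mulr_ge0 ?(ltW tau0) ?(le_trans ler01 E1).
  have h1 : (1 + ka * tau) * V n <= F * (n%:R * tau * q * E).
    by rewrite ler_pM// addr_ge0.
  have h2 : c3 * tau ^+ 2 <= tau * q * (F * E).
    rewrite (_ : c3 * tau ^+ 2 = tau * q); last by rewrite /q; ring.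
    rewrite ler_peMr ?mulr_ge0 ?(ltW tau0)// mulr_ege1//.
    by apply: le_trans e1; rewrite lerDl.
  rewrite -natr1; apply: le_trans (lerD h1 h2) _.
  by rewrite le_eqVlt; apply/orP; left; apply/eqP; ring.
have Vc n : (n <= N)%N -> V n <= c4 * tau.
  move=> nN; apply: le_trans (Vb n nN) _.
  have nT : n%:R * tau <= T by rewrite -NT ler_wpM2r ?(ltW tau0)// ler_nat.
  have n0 : 0 <= n%:R * tau by rewrite mulr_ge0 ?(ltW tau0).
  have ct : 0 <= c3 * tau by rewrite mulr_ge0 ?(ltW tau0).
  rewrite (_ : c4 * tau = T * (c3 * tau) * expR (ka * T)); last by rewrite c4E; ring.
  apply: ler_pM; [exact: mulr_ge0 | exact: expR_ge0 | exact: ler_wpM2r |].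
  by rewrite ler_expR; apply: ler_wpM2l => //; exact: ltW.
have ab n : (n <= N)%N -> a n <= c4 * tau.
  move=> nN; apply: le_trans (Vc n nN).
  by rewrite lerDl !mulr_ge0 ?(ltW th0) ?(ltW tau0).
have bb n : (n <= N)%N -> b n <= c4 / th.
  move=> nN; rewrite ler_pdivlMr// -(ler_pM2l tau0).
  have := Vc n nN; have := age n; rewrite /V; lra.
have bt n : (n <= N)%N -> b n <= c7 * tau.
  elim: n => [_|n IH nN]; first by rewrite b0 mulr_ge0 ?(ltW tau0).
  have tT := tauT (leq_ltn_trans (leq0n _) nN).
  apply: le_trans (bS n nN) _; have := IH (ltnW nN) => {}IH.
  have := ab n (ltnW nN); have := bb n (ltnW nN) => hb ha.
  have h : be * tau * (a n + b n) + c1 * tau ^+ 2 <= c6 * tau.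
    have -> : c6 * tau = be * tau * (c4 * T + c4 / th) + c1 * T * tau.
      by rewrite c6E; ring.
    rewrite lerD// ?ler_wpM2l ?mulr_ge0 ?(ltW be0) ?(ltW tau0)//.
      by rewrite lerD// (le_trans ha)// ler_wpM2l.
    by rewrite expr2 mulrA ler_wpM2r ?(ltW tau0)// ler_wpM2l.
  apply: le_trans (_ : rho * (c7 * tau) + (c6 + c2) * tau <= _).
    have x0 : 0 <= be * tau * (a n + b n) + c1 * tau ^+ 2.
      by rewrite !addr_ge0// !mulr_ge0 ?addr_ge0 ?(ltW be0) ?(ltW tau0).
    move: h x0; set x := be * tau * _ + _ => h x0.
    have -> : rho * (b n + x + c2 * tau) = rho * b n + rho * (x + c2 * tau) by ring.
    apply: lerD; first exact: ler_wpM2l.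
    apply: le_trans (_ : x + c2 * tau <= _); last by rewrite mulrDl lerD2r.
    apply: ler_piMl; last exact: ltW.
    by apply: addr_ge0 => //; apply: mulr_ge0 => //; exact: ltW.
  by rewrite -c7E le_eqVlt; apply/orP; left; apply/eqP; ring.
move=> n nN; split.
  by apply: le_trans (ab n nN) _; rewrite ler_wpM2r ?(ltW tau0)// lerDl.
by apply: le_trans (bt n nN) _; rewrite ler_wpM2r ?(ltW tau0)// lerDr.
Qed.

(** * Differentiation in time *)

Section time.
Context {R : realType} (T : R).
Local Notation I := [set t : R | 0 <= t <= T].

(** Clearing the denominator of the difference quotient puts the point s = t and the
    one-sided limits at the end points on the same footing as the others. *)
Lemma derive_on_expansion n (y : R -> 'cV[R]_n) t e : derivable_on I y -> I t -> 0 < e ->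
  exists2 d : R, 0 < d & forall s, I s -> `|s - t| < d ->
    `|y s - y t - (s - t) *: derive_on I y t| <= e * `|s - t|.
Proof.
move=> dy It e0; have /cvgrPdist_lt/(_ e e0) := dy t It.
rewrite !near_withinE => /nbhs_ballP[d /= d0 hd]; exists d => // s Is st.
have [->|nst] := eqVneq s t; first by rewrite !subrr scale0r subr0 !normr0 mulr0.
have st0 : s - t != 0 by rewrite subr_eq0.
have := hd s; rewrite /ball /= distrC => /(_ st nst Is).
rewrite -/(derive_on I y t) /diff_quot distrC => /ltW h.
rewrite (_ : _ - _ - _ = (s - t) *: ((s - t)^-1 *: (y s - y t) - derive_on I y t)).
  by rewrite normrZ mulrC ler_wpM2r.
by rewrite scalerBr scalerA divff// scale1r.
Qed.

(** Inside the interval the relative expansion is a derivative in the usual sense; at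
    the end points it still gives one-sided continuity, which is all that the mean
    value theorem asks there. *)
Lemma MVT_expansion (f df : R -> R) :
  (forall t, I t -> forall e, 0 < e -> exists2 d : R, 0 < d &
     forall s, I s -> `|s - t| < d -> `|f s - f t - (s - t) * df t| <= e * `|s - t|) ->
  forall a b, I a -> I b -> a < b ->
  exists2 c, a < c < b & f b - f a = df c * (b - a).
Proof.
move=> hf a b /= /andP[a0 aT] /andP[b0 bT] ab.
have cf t : I t -> forall e, 0 < e -> exists2 d : R, 0 < d &
    forall s, I s -> `|s - t| < d -> `|f t - f s| < e.
  move=> It e e0; have [d d0 hd] := hf t It 1 ltr01.
  have m0 : 0 < 2 + `|df t| by rewrite ltr_wpDr.
  exists (Num.min d (e / (2 + `|df t|))); first by rewrite lt_min d0 divr_gt0.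
  move=> s Is; rewrite lt_min => /andP[sd se].
  have := hd s Is sd; rewrite mul1r => h.
  rewrite distrC; have := ler_normD (f s - f t - (s - t) * df t) ((s - t) * df t).
  rewrite subrK normrM => h2; apply: le_lt_trans h2 _.
  move: se; rewrite ltr_pdivlMr// => se; apply: le_lt_trans se.
  have := normr_ge0 (s - t); have := normr_ge0 (df t); nra.
have Isub s : s \in `]a, b[ -> I s.
  rewrite in_itv/= => /andP[h1 h2]; rewrite /= (le_trans a0 (ltW h1))/=.
  exact: le_trans (ltW h2) bT.
have [| |c cab e] := @MVT R f df a b ab.
- move=> x xab; have Ix := Isub _ xab.
  move: (xab); rewrite in_itv/= => /andP[ax xb].
  have cv : h^-1 *: (f (h *: 1 + x) - f x) @[h --> 0^'] --> df x.
    apply/cvgrPdist_le => e e0; have [d d0 hd] := hf x Ix e e0.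
    rewrite near_withinE; apply/nbhs_ballP.
    exists (Num.min d (Num.min (x - a) (b - x))) => /=.
      by rewrite !lt_min d0 !subr_gt0 ax xb.
    move=> h; rewrite /ball /= sub0r normrN !lt_min => /and3P[hd0 ha hb] h0.
    have Ihx : I (h *: 1 + x).
      apply: Isub; rewrite in_itv/= /GRing.scale/= mulr1.
      move: ha hb; rewrite !ltr_norml => /andP[? ?] /andP[? ?].
      by apply/andP; split; lra.
    have := hd _ Ihx; rewrite addrK /GRing.scale/= mulr1 => /(_ hd0) hh.
    have -> : df x - h^-1 * (f (h + x) - f x)
            = - (h^-1 * (f (h + x) - f x - h * df x)).
      by rewrite [in RHS]mulrBr mulKf// opprB.
    by rewrite normrN normrM normfV mulrC ler_pdivrMr ?normr_gt0.
  apply: DeriveDef; first by apply/cvg_ex; exists (df x).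
  exact: cvg_lim cv.
- apply/continuous_within_itvP => //; split.
  + move=> x xab; apply/cvgrPdist_lt => e e0.
    have [d d0 hd] := cf x (Isub _ xab) e e0.
    move: xab; rewrite in_itv/= => /andP[ax xb].
    apply/nbhs_ballP; exists (Num.min d (Num.min (x - a) (b - x))) => /=.
      by rewrite !lt_min d0 !subr_gt0 ax xb.
    move=> s; rewrite /ball /= !lt_min distrC => /and3P[sd sa sb].
    apply: hd => //; apply: Isub; rewrite in_itv/=.
    move: sa sb; rewrite !ltr_norml => /andP[? ?] /andP[? ?].
    by apply/andP; split; lra.
  + apply/cvgrPdist_lt => e e0.
    have [|d d0 hd] := cf a _ e e0; first by rewrite /= a0 (le_trans (ltW ab)).
    rewrite near_withinE; apply/nbhs_ballP.
    exists (Num.min d (b - a)) => /=; first by rewrite lt_min d0 subr_gt0.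
    move=> s; rewrite /ball /= lt_min distrC => /andP[sd sb] sa.
    apply: hd => //=; move: sb; rewrite ltr_norml => /andP[? ?].
    by apply/andP; split; lra.
  + apply/cvgrPdist_lt => e e0.
    have [|d d0 hd] := cf b _ e e0; first by rewrite /= bT b0.
    rewrite near_withinE; apply/nbhs_ballP.
    exists (Num.min d (b - a)) => /=; first by rewrite lt_min d0 subr_gt0.
    move=> s; rewrite /ball /= lt_min distrC => /andP[sd sb] sa.
    apply: hd => //=; move: sb; rewrite ltr_norml => /andP[? ?].
    by apply/andP; split; lra.
- by exists c => //; move: cab; rewrite in_itv.
Qed.

Lemma mean_value_coord n (y : R -> 'cV[R]_n) i a b : derivable_on I y ->
  I a -> I b -> a < b -> exists2 c, a < c < b &
  y b i ord0 - y a i ord0 = (b - a) * derive_on I y c i ord0.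
Proof.
move=> dy Ia Ib ab.
have hy t : I t -> forall e, 0 < e -> exists2 d : R, 0 < d &
    forall s, I s -> `|s - t| < d ->
    `|y s i ord0 - y t i ord0 - (s - t) * derive_on I y t i ord0| <= e * `|s - t|.
  move=> It e e0; have [d d0 hd] := derive_on_expansion dy It e0; exists d => // s Is st.
  apply: le_trans (hd s Is st); apply: le_trans (coord_le_normv _ i).
  by rewrite !mxE.
have [c cab ->] :=
  @MVT_expansion (fun s => y s i ord0) (fun s => derive_on I y s i ord0) hy a b Ia Ib ab.
by exists c => //; rewrite mulrC.
Qed.

(** The maximum norm makes the coordinatewise mean value theorem sufficient. *)
Lemma lipschitz_of_derive_on n (y : R -> 'cV[R]_n) L a b :
  derivable_on I y -> (forall t, I t -> `|derive_on I y t| <= L) ->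
  I a -> I b -> a <= b -> `|y b - y a| <= (b - a) * L.
Proof.
move=> dy hL Ia Ib ab; have L0 : 0 <= L by apply: le_trans (hL _ Ia).
have ab0 : 0 <= b - a by rewrite subr_ge0.
move: ab; rewrite le_eqVlt => /predU1P[->|ab]; first by rewrite !subrr normr0 mul0r.
apply: normv_bound => [|i]; first exact: mulr_ge0.
have [c /andP[ac cb]] := mean_value_coord i dy Ia Ib ab.
rewrite !mxE => ->; rewrite normrM ger0_norm// ler_wpM2l//.
apply: le_trans (coord_le_normv _ _) (hL _ _).
move: Ia Ib => /andP[a0 _] /andP[_ bT] /=.
by rewrite (le_trans a0 (ltW ac)) (le_trans (ltW cb) bT).
Qed.

(** The second derivative controls the defect of the backward difference: by the
    mean value theorem the difference quotient is a value of y' in between. *)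
Lemma backward_euler_defect n (y : R -> 'cV[R]_n) L a b :
  Ck I 2 y -> Ck_bounded I 2 L y -> I a -> I b -> a <= b ->
  `|y b - y a - (b - a) *: derive_on I y b| <= (b - a) ^+ 2 * L.
Proof.
move=> [dy [ddy _]] hL Ia Ib ab; have L0 : 0 <= L by apply: le_trans (hL 0%N _ _ Ia).
have ab0 : 0 <= b - a by rewrite subr_ge0.
move: ab; rewrite le_eqVlt => /predU1P[->|ab].
  by rewrite !subrr scale0r subrr normr0 expr2 mul0r mul0r.
apply: normv_bound => [|i]; first by rewrite mulr_ge0 ?exprn_ge0.
have [c /andP[ac cb] e] := mean_value_coord i dy Ia Ib ab.
have Ic : I c.
  move: Ia Ib => /andP[a0 _] /andP[_ bT] /=.
  by rewrite (le_trans a0 (ltW ac)) (le_trans (ltW cb) bT).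
rewrite !mxE e -mulrBr normrM ger0_norm// expr2 -mulrA ler_wpM2l// distrC.
have := lipschitz_of_derive_on ddy (fun t => hL 2%N t isT) Ic Ib (ltW cb) => h.
have := le_trans (coord_le_normv _ i) h; rewrite !mxE => h'.
apply: le_trans h' _; rewrite ler_wpM2r// lerD2l lerN2 ltW//.
Qed.

End time.

(** * Convergence of the damped scheme *)

Section schur.
Context {R : realType} (n_u n_p : nat) (A : 'M[R]_n_u) (D : 'M[R]_(n_p, n_u)).
Hypothesis sA : spd A.

(** The operator acting on the pressure once the displacement is eliminated. *)
Definition schur := D *m invmx A *m D^T.

Lemma sqnorm_schur q :
  sqnorm schur q = sqnorm A (invmx A *m (D^T *m q)).
Proof.
have Aw : A *m (invmx A *m (D^T *m q)) = D^T *m q.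
  by rewrite mulmxA mulmxV ?mul1mx ?spd_unitmx.
by rewrite [RHS]sqnormE Aw dotv_mul trmxK dotvC sqnormE /schur -!mulmxA.
Qed.

Lemma psd_schur : psd schur.
Proof.
have [AT _] := sA; split=> [|v].
  by rewrite /schur !trmx_mul trmxK trmx_inv AT mulmxA.
by rewrite sqnorm_schur; have [_ ->] := spd_psd sA.
Qed.

Lemma schur_mul (x : 'cV_n_u) (q : 'cV_n_p) : A *m x = D^T *m q -> D *m x = schur *m q.
Proof.
by move=> Ax; rewrite /schur -!mulmxA -Ax mulKmx// spd_unitmx.
Qed.

Lemma sqnorm_schur_mul (x : 'cV_n_u) (q : 'cV_n_p) :
  A *m x = D^T *m q -> sqnorm A x = sqnorm schur q.
Proof. by move=> Ax; rewrite sqnorm_schur -Ax mulKmx// spd_unitmx. Qed.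

End schur.

Section convergence.
Context {R : realType} (n_u n_p : nat).
Variables (A : 'M[R]_n_u) (B C : 'M[R]_n_p) (D : 'M[R]_(n_p, n_u)).
Hypotheses (sA : spd A) (sB : spd B) (sC : spd C).
Local Notation S := (schur A D).

Section one_step.
Variables (tau omega : R).
Hypotheses (tau0 : 0 <= tau) (omega0 : 0 < omega).
Hypothesis SC : forall q, sqnorm S q <= omega * sqnorm C q.
Local Notation X := (C + tau *: B).

Lemma spd_Ctau : spd X.
Proof. by apply: spdD => //; apply: psdZ => //; exact: spd_psd. Qed.

Lemma sqnorm_Ctau_mono v : sqnorm C v <= sqnorm X v.
Proof.
rewrite [leRHS]sqnormE mulmxDl dotvDr -sqnormE lerDl -sqnormE.
by have [_ ->] := psdZ tau0 (spd_psd sB).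
Qed.

Lemma schur_le_Ctau q : sqnorm S q <= omega * sqnorm X q.
Proof.
by apply: le_trans (SC q) _; rewrite ler_wpM2l ?(ltW omega0)// sqnorm_Ctau_mono.
Qed.

(** The equation is tested with w, and S >= 0 keeps the left-hand side above |w|_X^2.
    The constants come from the C-norm, so they are the same for all tau. *)
Lemma implicit_increment_le (bB c1 : R) w e d :
  0 <= bB -> 0 <= c1 ->
  (forall v, enorm B v <= bB * enorm C v) ->
  (forall v, `|v| <= c1 * enorm C v) ->
  (X + S) *m w = - (tau *: (B *m e)) + d ->
  enorm X w <= bB ^+ 2 * tau * enorm X e + n_p%:R * c1 * `|d|.
Proof.
move=> bB0 c10 hB hc hw.
have CX v : enorm C v <= enorm X v by exact/enorm_mono/sqnorm_Ctau_mono.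
have BX v : enorm B v <= bB * enorm X v.
  by apply: le_trans (hB v) _; rewrite ler_wpM2l.
have nX v : `|v| <= c1 * enorm X v.
  by apply: le_trans (hc v) _; rewrite ler_wpM2l.
have [w0|w0] := eqVneq (enorm X w) 0.
  by rewrite w0 addr_ge0// !mulr_ge0 ?exprn_ge0.
have {}w0 : 0 < enorm X w by rewrite lt_neqAle eq_sym w0 enorm_ge0.
rewrite -(ler_pM2l w0) -expr2 (sqr_enorm _ (spd_psd spd_Ctau)).
have [_ S0] := psd_schur D sA.
have : sqnorm X w <= sqnorm (X + S) w.
  by rewrite [leRHS]sqnormE mulmxDl dotvDr -!sqnormE lerDl.
rewrite [leRHS]sqnormE hw dotvDr dotvNr dotvZr => /le_trans; apply.
have h1 : - (tau * dotv w (B *m e)) <= tau * (bB * enorm X w * (bB * enorm X e)).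
  rewrite -mulrN ler_wpM2l// (le_trans (ler_norm _))// normrN.
  by rewrite (le_trans (dotv_le_enorm _ _ (spd_psd sB)))// ler_pM.
have h2 : dotv w d <= n_p%:R * (c1 * enorm X w) * `|d|.
  rewrite (le_trans (ler_norm _))// (le_trans (dotv_le_norm _ _))//.
  by rewrite ler_wpM2r// ler_wpM2l.
by apply: le_trans (lerD h1 h2) _; rewrite le_eqVlt; apply/orP; left; apply/eqP; ring.
Qed.

End one_step.

(** The analytic input of the forms is confined to the bound S <= omega C. *)
Theorem damped_scheme_order_one (T omega : R) (K : nat)
    (f : R -> 'cV[R]_n_u) (g : R -> 'cV[R]_n_p) (L : R)
    (I := [set t : R | 0 <= t <= T]) :
  0 < T -> 0 < omega ->
  (forall q, sqnorm S q <= omega * sqnorm C q) ->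
  (1 <= K)%N -> omega ^+ K / (2 + omega) ^+ (K - 1) < 1 ->
  exists2 Cst : R, 0 < Cst & forall N : nat, (1 <= N)%N -> let tau := T / N%:R in
    forall u0 p0 u p, semi_discrete_solution A B C D f g I u0 p0 u p ->
    Ck I 2 u -> Ck I 2 p -> Ck_bounded I 2 L u -> Ck_bounded I 2 L p ->
    forall un pn, damped_scheme A B C D f g tau (2 / (2 + omega)) K N u0 p0 un pn ->
    forall n : nat, (n <= N)%N ->
      sqnorm A (un n - u (n%:R * tau)) + sqnorm B (pn n - p (n%:R * tau))
        <= Cst * tau ^+ 2.
Proof.
move=> T0 w0 SC; case: K => // k _; rewrite subSS subn0 => rho1.
have I0 : I 0 by rewrite /I /= lexx ltW.
have [c1 c10 hc1] := norm_le_enorm sC.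
have [bB bB0 hbB] := enorm_le_enorm sC (spd_psd sB).
have [kD kD0 hkD] := norm_mulmx_le D.
have [kC kC0 hkC] := norm_mulmx_le C.
have [kX kX0 hkX] := enorm_le_norm (spd_psd (spd_Ctau (ltW T0))).
pose ct := n_p%:R * c1 * ((kD + kC) * `|L|).
have ct0 : 0 <= ct by rewrite /ct !mulr_ge0// addr_ge0.
pose c2 := kX * `|L|; have c20 : 0 <= c2 by rewrite /c2 mulr_ge0.
pose th := omega / (2 + omega).
have w20 : 0 < 2 + omega by rewrite addr_gt0.
have th0 : 0 <= th by rewrite /th divr_ge0 ?(ltW w0) ?(ltW w20).
have th1 : th <= 1 by rewrite /th ler_pdivrMr// mul1r lerDr.
have rhoE : omega ^+ k.+1 / (2 + omega) ^+ k = omega * th ^+ k.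
  by rewrite exprS /th exprMn exprVn mulrA.
rewrite rhoE in rho1.
have be0 : 0 < bB ^+ 2 + 1 by rewrite ltr_wpDl// exprn_ge0.
have [|G G0 hG] := @coupled_recursion R T (omega * th ^+ k) (bB ^+ 2 + 1) ct c2
  T0 _ be0 ct0 c20.
  by rewrite rho1 mulr_ge0 ?exprn_ge0 ?(ltW w0).
(* e is at most 2 G tau; s is at most z + h + (increment of z) + c2 tau *)
exists (omega * (4 * G + c2) ^+ 2 + (bB * (2 * G)) ^+ 2 + 1).
  by apply: ltr_wpDl => //; apply: addr_ge0; [apply: mulr_ge0; [exact: ltW|] | ]; exact: sqr_ge0.
move=> N N1 tau u0 p0 u p [hA hD u00 p00] Cu Cp Lu Lp un pn [un0 pn0 sch].
have N0 : 0 < N%:R :> R by rewrite ltr0n.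
have tau0 : 0 < tau by rewrite divr_gt0.
have NT : N%:R * tau = T by rewrite /tau mulrC divfK// gt_eqF.
have tauT : tau <= T by rewrite /tau ler_pdivrMr// ler_peMr ?(ltW T0)// ler1n.
have It n : (n <= N)%N -> I (n%:R * tau).
  move=> nN; rewrite /I /= mulr_ge0 ?(ltW tau0)//= -NT.
  by rewrite ler_wpM2r ?(ltW tau0)// ler_nat.
have L0 : 0 <= L by apply: le_trans (Lu 0%N 0 isT I0).
have LE : `|L| = L by rewrite ger0_norm.
pose X := C + tau *: B.
have sX : spd X by apply: spd_Ctau; exact: ltW.
have pX := spd_psd sX.
have pS := psd_schur D sA.
have SX q : sqnorm S q <= omega * sqnorm X q by apply: schur_le_Ctau => //; exact: ltW.
have CX v : enorm C v <= enorm X v.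
  by apply: enorm_mono; apply: sqnorm_Ctau_mono; exact: ltW.
have Xk v : enorm X v <= kX * `|v|.
  apply: le_trans (hkX v); apply: enorm_mono.
  rewrite !sqnormE !mulmxDl !dotvDr lerD2l -!scalemxAl !dotvZr ler_wpM2r//.
  by rewrite -sqnormE; have [_ ->] := spd_psd sB.
pose U n := u (n%:R * tau); pose P n := p (n%:R * tau).
have dt n : n.+1%:R * tau - n%:R * tau = tau by rewrite -mulrBl -natr1 addrAC subrr add0r mul1r.
have tle n : n%:R * tau <= n.+1%:R * tau by rewrite -subr_ge0 dt ltW.
(* e is the pressure error; for n > 0, z is the error of the fixed point of the inner
   iteration that ends at time n, and h the distance of the iterate to it *)
pose e n := pn n - P n; pose eta n := D *m (un n - U n).
pose z n := invmx (X + S) *m (X *m e n + eta n).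
have uXS : X + S \in unitmx by apply: spd_unitmx; exact: spdD.
have zE n : (X + S) *m z n = X *m e n + eta n by rewrite mulKVmx.
pose h n := e n - z n.
have ehz n : e n = h n + z n by rewrite /h subrK.
have e0 : e 0%N = 0 by rewrite /e /P pn0 mul0r p00 subrr.
have x0 : un 0%N - U 0%N = 0 by rewrite /U un0 mul0r u00 subrr.
have z0 : z 0%N = 0 by rewrite /z e0 /eta x0 !mulmx0 addr0 mulmx0.
have h0 : h 0%N = 0 by rewrite /h e0 z0 subrr.
(* implicit Euler for z; d is its truncation error *)
have zS n : (n < N)%N -> enorm X (z n.+1 - z n) <=
    (bB ^+ 2 + 1) * tau * (enorm X (z n) + enorm X (h n)) + ct * tau ^+ 2.
  move=> nN.
  have In := It n (ltnW nN); have In1 := It n.+1 nN.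
  pose d := - (D *m (U n.+1 - U n - tau *: derive_on I u (n.+1%:R * tau))
             + C *m (P n.+1 - P n - tau *: derive_on I p (n.+1%:R * tau))).
  have hd : `|d| <= (kD + kC) * `|L| * tau ^+ 2.
    rewrite /d normrN (le_trans (ler_normD _ _))// -mulrA mulrDl LE (mulrC L).
    rewrite lerD//.
      rewrite (le_trans (hkD _))// ler_wpM2l//.
      by have := backward_euler_defect Cu Lu In In1 (tle n); rewrite dt.
    rewrite (le_trans (hkC _))// ler_wpM2l//.
    by have := backward_euler_defect Cp Lp In In1 (tle n); rewrite dt.
  have hw : (X + S) *m (z n.+1 - z n) = - (tau *: (B *m e n)) + d.
    rewrite mulmxBr !zE.
    have [uh [uk [ph [pk /(_ n nN)[_ in1 _ [uK uhK] [pK phK]]]]]] := sch.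
    have [_ last] := in1 k (ltnSn k).
    rewrite -phK -pK -uhK -uK in last.
    have := hD _ In1; rewrite -/(P n.+1).
    set du := derive_on I u _ in d hd *; set dp := derive_on I p _ in d hd *.
    move=> gE; rewrite -gE -/X in last.
    rewrite /d /e /eta !mulmxBr last /X !mulmxDl -!scalemxAl -!scalemxAr.
    (* a linear identity between opaque vectors, checked entrywise *)
    move: (D *m un n) (D *m un n.+1) (D *m U n) (D *m U n.+1) (D *m du) => a1 a2 a3 a4 a5.
    move: (C *m pn n) (C *m P n) (C *m P n.+1) (C *m dp) => b1 b2 b3 b4.
    move: (B *m pn n) (B *m P n) (B *m P n.+1) => d1 d2 d3.
    by apply/matrixP => i j; rewrite !mxE; ring.
  have := implicit_increment_le (ltW tau0) bB0 c10 hbB hc1 hw.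
  move=> /le_trans; apply.
  apply: lerD.
    have zh : enorm X (e n) <= enorm X (z n) + enorm X (h n).
      by rewrite ehz addrC enormD.
    apply: ler_pM => //; first by rewrite mulr_ge0 ?exprn_ge0 ?(ltW tau0).
    by rewrite ler_wpM2r ?(ltW tau0)// lerDl.
  by rewrite /ct -[leRHS]mulrA ler_wpM2l// mulr_ge0.
(* s is the error of the pressure which determines the new displacement *)
have inner n : (n < N)%N -> exists2 s, A *m (un n.+1 - U n.+1) = D^T *m s &
    enorm X s <= enorm X (z n.+1) + (enorm X (h n) + enorm X (z n.+1 - z n) + c2 * tau)
    /\ enorm X (h n.+1) <=
       omega * th ^+ k * (enorm X (h n) + enorm X (z n.+1 - z n) + c2 * tau).
  move=> nN; have In := It n (ltnW nN); have In1 := It n.+1 nN.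
  have [uh [uk [ph [pk /(_ n nN)[[uk0 pk0] in1 in2 [uK uhK] [pK phK]]]]]] := sch.
  have [_ last] := in1 k (ltnSn k).
  rewrite -phK -pK -uhK -uK in last.
  (* y j is the distance of the j-th inner iterate to the fixed point P n.+1 + z n.+1 *)
  pose y j := pk n j - P n.+1 - z n.+1.
  have AU : A *m U n.+1 = f (n.+1%:R * tau) + D^T *m P n.+1.
    by rewrite -(hA _ In1) subrK.
  have Auh j : (j < k.+1)%N -> A *m (uh n j.+1 - U n.+1) = D^T *m (pk n j - P n.+1).
    move=> jk; have [Aj _] := in1 j jk.
    by rewrite mulmxBr Aj AU mulmxBr opprD addrACA subrr add0r.
  have yE j : (j < k.+1)%N -> X *m (ph n j.+1 - P n.+1 - z n.+1) = - (S *m y j).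
    move=> jk; have [_ phE] := in1 j jk.
    have Suh := schur_mul sA (Auh j jk).
    have zy : X *m (ph n j.+1 - P n.+1) + S *m (pk n j - P n.+1) = (X + S) *m z n.+1.
      rewrite zE -Suh /e /eta !mulmxBr phE last.
      move: (X *m P n.+1) (D *m uh n j.+1) (D *m un n.+1) => a1 a2 a3.
      move: (D *m un n) (C *m pn n) (D *m U n.+1) => a4 a5 a6.
      by apply/matrixP => i l; rewrite !mxE; ring.
    rewrite /y mulmxBr (mulmxBr S) opprB.
    have -> : X *m (ph n j.+1 - P n.+1)
            = X *m z n.+1 + S *m z n.+1 - S *m (pk n j - P n.+1).
      by rewrite -mulmxDl -zy addrK.
    by rewrite -(addrA (X *m z n.+1)) addrAC subrr add0r.
  have y0 : enorm X (y 0%N) <= enorm X (h n) + enorm X (z n.+1 - z n) + c2 * tau.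
    have -> : y 0%N = h n + - (z n.+1 - z n) + - (P n.+1 - P n).
      rewrite /y pk0 /h /e.
      by apply/matrixP => i j; rewrite !mxE; ring.
    rewrite (le_trans (enormD _ _ pX))// lerD//.
      by rewrite (le_trans (enormD _ _ pX))// enormN.
    rewrite enormN (le_trans (Xk _))// /c2 -mulrA ler_wpM2l// LE.
    have [dp _] := Cp.
    have := lipschitz_of_derive_on dp (fun t => Lp 1%N t isT) In In1 (tle n).
    by rewrite dt [tau * L]mulrC.
  have yk j : (j <= k)%N -> enorm X (y j) <= th ^+ j * enorm X (y 0%N).
    elim: j => [_|j IH jk]; first by rewrite expr0 mul1r.
    have [_ ypj] := in2 j jk.
    have := enorm_damped_le pX pS w0 SX (yE j (ltnW jk)).
    rewrite -/th (_ : _ + _ *: y j = y j.+1).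
      move=> /le_trans; apply; rewrite exprS -mulrA; apply: ler_wpM2l => //.
      by apply: IH; exact: ltnW.
    rewrite /y ypj.
    by apply/matrixP => i l; rewrite !mxE; ring.
  exists (pk n k - P n.+1); first by rewrite uK uhK Auh.
  split.
    rewrite (_ : _ - _ = z n.+1 + y k); last by rewrite /y [RHS]addrC subrK.
    rewrite (le_trans (enormD _ _ pX))// lerD2l.
    rewrite (le_trans (yk k (leqnn k)))// (le_trans _ y0)//.
    by rewrite ler_piMl// exprn_ile1.
  have -> : h n.+1 = ph n k.+1 - P n.+1 - z n.+1 by rewrite /h /e pK phK.
  rewrite (le_trans (enorm_solve_le pX pS w0 SX (yE k (ltnSn k))))//.
  rewrite -mulrA ler_wpM2l ?(ltW w0)// (le_trans (yk k (leqnn k)))//.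
  by rewrite ler_wpM2l// exprn_ge0.
have zhG : forall n, (n <= N)%N -> enorm X (z n) <= G * tau /\ enorm X (h n) <= G * tau.
  apply: (hG tau N (fun n => enorm X (z n)) (fun n => enorm X (h n))) => //=.
  - by rewrite z0 enorm0.
  - by rewrite h0 enorm0.
  - move=> n nN; have {1}-> : z n.+1 = z n + (z n.+1 - z n) by rewrite addrC subrK.
    by rewrite (le_trans (enormD _ _ pX))// lerD2l zS.
  - move=> n nN; have [s _ [_ hs]] := inner n nN.
    apply: le_trans hs _; rewrite ler_wpM2l ?mulr_ge0 ?exprn_ge0 ?(ltW w0)//.
    by rewrite lerD2r lerD2l zS.
have eG n : (n <= N)%N -> enorm B (e n) <= bB * (2 * G * tau).
  move=> nN; have [hz hh] := zhG n nN.
  rewrite (le_trans (hbB _))// ler_wpM2l// (le_trans (CX _))// ehz.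
  by rewrite (le_trans (enormD _ _ pX))//; lra.
have xG n : (n <= N)%N -> sqnorm A (un n - U n) <= omega * ((4 * G + c2) * tau) ^+ 2.
  case: n => [_|n nN]; first by rewrite x0 sqnorm0 mulr_ge0 ?sqr_ge0 ?(ltW w0).
  have [s As [hs _]] := inner n nN.
  rewrite (sqnorm_schur_mul sA As) (le_trans (SX _))// ler_wpM2l ?(ltW w0)//.
  rewrite -(sqr_enorm _ pX) ler_pXn2r ?nnegrE//; last first.
    by apply: mulr_ge0; [apply: addr_ge0 => //; apply: mulr_ge0|exact: ltW].
  have [hz hh] := zhG n (ltnW nN); have [hz' _] := zhG n.+1 nN.
  have : enorm X (z n.+1 - z n) <= enorm X (z n.+1) + enorm X (z n).
    by rewrite (le_trans (enormD _ _ pX))// enormN.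
  move: hs hz hh hz'; rewrite mulrDl; lra.
move=> n nN.
have hB : sqnorm B (pn n - p (n%:R * tau)) <= (bB * (2 * G * tau)) ^+ 2.
  rewrite -(sqr_enorm _ (spd_psd sB)) ler_pXn2r ?nnegrE//; first exact: eG.
  by apply: mulr_ge0 => //; apply: mulr_ge0; [exact: mulr_ge0|exact: ltW].
apply: le_trans (lerD (xG n nN) hB) _.
have := sqr_ge0 tau; nra.
Qed.

End convergence.

(** * Open sets and continuous functions on row vectors are measurable *)

Section measurable_open.
Context {R : realType} (m : nat).

(** The sigma-algebra generated by the coordinates contains the open sets, because
    an open set is the union of the boxes with rational data that it contains. *)
Lemma open_measurable_rV (O : set 'rV[R]_m) : open O -> measurable O.
Proof.
move=> oO.
pose box (q : 'rV[rat]_m * nat) : set 'rV[R]_m :=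
  [set x | forall i, `|x ord0 i - ratr (q.1 ord0 i)| < q.2.+1%:R^-1].
have mbox q : measurable (box q).
  rewrite (_ : box q = \bigcap_(i in [set: 'I_m]) (coord_rV i @^-1`
      [set y : R | `|y - ratr (q.1 ord0 i)| < q.2.+1%:R^-1])).
    apply: fin_bigcap_measurable => // i _.
    rewrite -[X in measurable X]setTI; apply: measurable_coord_rV => //.
    apply: open_measurable.
    rewrite (_ : [set y | _] = ball (ratr (q.1 ord0 i) : R) q.2.+1%:R^-1).
      exact: ball_open.
    by apply/seteqP; split=> y; rewrite /ball/= distrC.
  by apply/seteqP; split=> x /= hx i; [move=> _; exact: hx | exact: hx].
pose F q := if `[< box q `<=` O >] then box q else set0.
rewrite (_ : O = \bigcup_q F q).
  apply: countable_bigcupT_measurable; first exact: countableP.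
  by move=> q; rewrite /F; case: ifP.
apply/seteqP; split=> [x Ox|x [q _]]; last by rewrite /F; case: asboolP => // qO /qO.
have /nbhs_ballP[e /= e0 he] : nbhs x O by exact: open_nbhs_nbhs.
have [k hk] : exists k : nat, k.+1%:R^-1 < e / 2.
  exists (Num.bound (e / 2)^-1).
  rewrite -ltf_pV2 ?posrE ?invr_gt0 ?divr_gt0// invrK.
  have := @archi_boundP _ ((e / 2)^-1); rewrite invr_ge0 divr_ge0 ?(ltW e0)// => /(_ isT) h.
  by apply: lt_trans h _; rewrite ltr_nat.
have kp : 0 < k.+1%:R^-1 :> R by rewrite invr_gt0.
have /choice[q hq] : forall i, exists q : rat, `|x ord0 i - ratr q| < k.+1%:R^-1.
  move=> i; have [|q] := @rat_in_itvoo R (x ord0 i - k.+1%:R^-1) (x ord0 i).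
    by rewrite ltrBlDr ltrDl.
  rewrite in_itv/= => /andP[h1 h2]; exists q.
  by rewrite gtr0_norm ?subr_gt0// ltrBlDr addrC -ltrBlDr.
have bx : box (\row_i q i, k) x by move=> i /=; rewrite mxE.
exists (\row_i q i, k) => //; rewrite /F asboolT// => y by_; apply: he.
split=> // i j; rewrite (ord1 i) /ball /=.
have := bx j; have := by_ j; rewrite /= !mxE => h1 h2.
have -> : x ord0 j - y ord0 j
  = (x ord0 j - ratr (q j)) - (y ord0 j - ratr (q j)) by ring.
apply: le_lt_trans (ler_normB _ _) _.
by rewrite [e]splitr ltrD// (lt_trans _ hk).
Qed.

Lemma continuous_measurable_rV (D : set 'rV[R]_m) (f : 'rV[R]_m -> R) :
  measurable D -> continuous f -> measurable_fun D f.
Proof.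
move=> mD /continuousP cf; apply: (measurability _ (RGenOpens.measurableE R)).
move=> _ [_ [a [b ->]] <-].
apply: measurableI => //; apply: open_measurable_rV; apply: cf.
exact: interval_open.
Qed.

End measurable_open.

(** * Symmetry of second partial derivatives *)

Section schwarz.
Context {R : realType} (m : nat).
Implicit Types v w : 'rV[R]_m -> R.
Local Notation ei i := (delta_mx ord0 i : 'rV[R]_m).

Lemma is_derive_line w (x e : 'rV[R]_m) (s : R) : derivable w (x + s *: e) e ->
  is_derive s 1 (fun s => w (x + s *: e)) ('D_e w (x + s *: e)).
Proof.
move=> dw.
have E : (fun h : R => h^-1 *: (w (x + (h *: 1 + s) *: e) - w (x + s *: e)))
  = (fun h : R => h^-1 *: (w (h *: e + (x + s *: e)) - w (x + s *: e))).
  apply/funext => h; congr (_ *: (w _ - _)).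
  by rewrite [h *: 1]mulr1 scalerDl addrCA.
apply: DeriveDef; first by rewrite /derivable E.
by rewrite /derive E.
Qed.

Lemma MVT_line (f : R -> R) (df : R -> R) (h : R) : 0 < h ->
  (forall s : R, is_derive s 1 f (df s)) ->
  exists2 c, 0 < c < h & f h - f 0 = h * df c.
Proof.
move=> h0 hf; have cf : {within `[0, h], continuous f}.
  by apply: derivable_within_continuous => s _; case: (hf s).
have [c] := @MVT R f df 0 h h0 (fun s _ => hf s) cf.
by rewrite in_itv /= subr0 mulrC => ch e; exists c.
Qed.

Lemma norm_delta_rV i : `|ei i| <= 1.
Proof.
rewrite [leLHS]/Num.Def.normr/= mx_normrE bigmax_le//= => -[k j] _ /=.
by rewrite mxE; case: (_ && _); rewrite ?normr1 ?normr0.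
Qed.

(** Two applications of the mean value theorem to the second difference of v over
    the square with sides h e_i and h e_j. *)
Lemma second_difference v i j x (h : R) : 0 < h ->
  (forall y, derivable v y (ei i)) ->
  (forall y, derivable (partial i v) y (ei j)) ->
  exists2 y, `|y - x| <= 2 * h &
    v (x + h *: ei i + h *: ei j) - v (x + h *: ei i) - v (x + h *: ei j) + v x
    = h ^+ 2 * partial j (partial i v) y.
Proof.
move=> h0 di dij.
have [|c /andP[c0 ch]] := @MVT_line
  (fun s => v (x + h *: ei j + s *: ei i) - v (x + s *: ei i))
  (fun s => partial i v (x + h *: ei j + s *: ei i) - partial i v (x + s *: ei i)) h h0.
  by move=> s; apply: is_deriveB; apply: is_derive_line.
have [|c' /andP[c'0 c'h]] := @MVT_line
  (fun s => partial i v (x + c *: ei i + s *: ei j))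
  (fun s => partial j (partial i v) (x + c *: ei i + s *: ei j)) h h0.
  by move=> s; apply: is_derive_line.
rewrite /= !scale0r !addr0 => e2 e1.
exists (x + c *: ei i + c' *: ei j).
  rewrite -(addrA x) (addrC x) addrK (le_trans (ler_normD _ _))// !normrZ.
  have := norm_delta_rV i; have := norm_delta_rV j.
  rewrite !gtr0_norm//; have := normr_ge0 (ei i); have := normr_ge0 (ei j); nra.
rewrite expr2 -mulrA -e2 [x + c *: _ + _]addrAC -e1 [x + h *: ei i + _]addrAC.
by ring.
Qed.

(** Schwarz's theorem once De is the second difference, which is symmetric in the two
    directions: both mixed derivatives are limits of De h / h^2. *)
Lemma eq_of_difference_quotient (a b : 'rV[R]_m -> R) (De : R -> R) x :
  continuous a -> continuous b ->
  (forall h, 0 < h -> exists2 y, `|y - x| <= 2 * h & De h = h ^+ 2 * a y) ->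
  (forall h, 0 < h -> exists2 y, `|y - x| <= 2 * h & De h = h ^+ 2 * b y) ->
  a x = b x.
Proof.
move=> ca cb ha hb; apply/eqP; rewrite -subr_eq0 -normr_le0.
apply/ler_addgt0Pr => e e0; rewrite add0r.
have e20 : 0 < e / 2 by rewrite divr_gt0.
have /cvgrPdist_lt/(_ _ e20)/nbhs_ballP[r1 /= r10 h1] := ca x.
have /cvgrPdist_lt/(_ _ e20)/nbhs_ballP[r2 /= r20 h2] := cb x.
pose h := Num.min r1 r2 / 3.
have h0 : 0 < h by rewrite divr_gt0// lt_min r10.
have hr1 : 2 * h < r1.
  by have : Num.min r1 r2 <= r1 by [rewrite ge_min lexx|]; rewrite /h; lra.
have hr2 : 2 * h < r2.
  by have : Num.min r1 r2 <= r2 by [rewrite ge_min lexx orbT|]; rewrite /h; lra.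
have [y yx ey] := ha h h0; have [z zx ez] := hb h h0.
have yz : a y = b z.
  by apply: (@mulfI _ (h ^+ 2)); rewrite ?expf_neq0 ?gt_eqF// -ey -ez.
have := h1 y; have := h2 z; rewrite -ball_normE /ball_ /= !(distrC x).
move=> /(_ (le_lt_trans zx hr2)) bz /(_ (le_lt_trans yx hr1)) ay.
have -> : a x - b x = (a x - a y) - (b x - b z) by rewrite yz opprB addrA subrK.
apply: le_trans (ler_normB _ _) _; rewrite [e]splitr.
by apply: lerD; exact: ltW.
Qed.

Lemma partialC v i j : smooth v -> partial i (partial j v) = partial j (partial i v).
Proof.
move=> sv; apply/funext => x.
have [cij _] := sv [:: i; j]; have [cji _] := sv [:: j; i].
have [_ d0] := sv [::]; have [_ di] := sv [:: i]; have [_ dj] := sv [:: j].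
pose De h := v (x + h *: ei i + h *: ei j) - v (x + h *: ei i) - v (x + h *: ei j) + v x.
apply: (@eq_of_difference_quotient _ _ De _ cij cji) => h h0.
  have [y yx ey] := @second_difference v j i x h h0 (d0 j) (dj i).
  by exists y => //; rewrite -ey /De [x + h *: ei j + _]addrAC [v _ - _ - _]addrAC.
exact: (@second_difference v i j x h h0 (d0 i) (di j)).
Qed.

Lemma smooth_partial v i : smooth v -> smooth (partial i v).
Proof.
move=> sv s; have := sv (rcons s i); rewrite /= -cats1 foldr_cat /=; exact.
Qed.

(** The compact set K is closed, so v vanishes in a neighbourhood of any point outside
    K and its derivatives vanish there too. *)
Lemma test_function_partial Om v i : test_function Om v -> test_function Om (partial i v).
Proof.
move=> [sv [K cK [KO v0]]]; split; first exact: smooth_partial.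
exists K => //; split=> // x Kx.
have cl : closed K by apply: compact_closed => //; exact: norm_hausdorff.
have : \forall y \near x, v y = cst 0 y.
  have : nbhs x (~` K) by apply: open_nbhs_nbhs; split => //; exact: closed_openC.
  by apply: filterS => y; exact: v0.
by move=> /(near_eq_derive (ei i)); rewrite derive_cst.
Qed.

End schwarz.

(** * Square-integrable functions *)

Section square_integrable.
Context {R : realType} (m : nat) (Om : set 'rV[R]_m).
Hypothesis mOm : measurable Om.
Implicit Types u v w : 'rV[R]_m -> R.
Local Notation leb := (@lebesgue_rV R m).

Definition L2dot u v : R := \int[leb]_(x in Om) (u x * v x).

Lemma L2_mul u v : L2 Om u -> L2 Om v ->
  leb.-integrable Om (EFin \o (fun x => u x * v x)).
Proof.
move=> [mu iu] [mv iv].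
apply: (@le_integrable _ _ _ _ _ mOm _
  (fun x => (u x ^+ 2)%:E + (v x ^+ 2)%:E)%E); last exact: integrableD.
- by apply/measurable_EFinP; exact: measurable_funM.
- move=> x _; rewrite -EFinD /= !lee_fin.
  rewrite [leRHS]ger0_norm ?addr_ge0 ?sqr_ge0// ler_norml.
  have := sqr_ge0 (u x + v x); have := sqr_ge0 (u x - v x).
  rewrite !expr2 => h1 h2; have := sqr_ge0 (u x); have := sqr_ge0 (v x).
  by rewrite !expr2 => h3 h4; apply/andP; split; lra.
Qed.

Lemma L2Z k u : L2 Om u -> L2 Om (fun x => k * u x).
Proof.
move=> [mu iu]; split; first exact: measurable_funM.
have := @integrableZl _ _ _ leb _ mOm (k ^+ 2) _ iu.
by apply: eq_integrable => // x _; rewrite -EFinM exprMn.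
Qed.

Lemma L2D u v : L2 Om u -> L2 Om v -> L2 Om (fun x => u x + v x).
Proof.
move=> Lu Lv; have [mu iu] := Lu; have [mv iv] := Lv.
split; first exact: measurable_funD.
have := integrableD mOm (integrableD mOm iu iv)
  (@integrableZl _ _ _ leb _ mOm 2 _ (L2_mul Lu Lv)).
apply: eq_integrable => // x _ /=; rewrite -EFinM -!EFinD; congr EFin; ring.
Qed.

Lemma L2_0 : L2 Om (fun=> 0).
Proof.
split; first exact: measurable_cst.
rewrite (_ : (fun x => _) = cst 0%E); first exact: integrable0.
by apply/funext => x /=; rewrite expr2 mul0r.
Qed.

Lemma L2_sum n (F : 'I_n -> 'rV[R]_m -> R) (c : 'I_n -> R) :
  (forall k, L2 Om (F k)) -> L2 Om (fun x => \sum_k c k * F k x).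
Proof.
elim: n F c => [|n IH] F c LF.
  rewrite (_ : (fun x => _) = fun=> 0); first exact: L2_0.
  by apply/funext => x; rewrite big_ord0.
rewrite (_ : (fun x => _) = fun x => c ord0 * F ord0 x +
    \sum_(k < n) c (lift ord0 k) * F (lift ord0 k) x).
  by apply: L2D; [exact: L2Z|apply: IH => k; exact: LF].
by apply/funext => x; rewrite big_ord_recl.
Qed.

Lemma L2dotC u v : L2dot u v = L2dot v u.
Proof. by congr fine; apply: eq_integral => x _; rewrite mulrC. Qed.

Lemma L2dotDl u v w : L2 Om u -> L2 Om v -> L2 Om w ->
  L2dot (fun x => u x + v x) w = L2dot u w + L2dot v w.
Proof.
move=> Lu Lv Lw; rewrite /L2dot -RintegralD//; try exact: L2_mul.
by apply: eq_Rintegral => x _; rewrite mulrDl.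
Qed.

Lemma L2dotDr u v w : L2 Om u -> L2 Om v -> L2 Om w ->
  L2dot w (fun x => u x + v x) = L2dot w u + L2dot w v.
Proof.
by move=> Lu Lv Lw; rewrite ![L2dot w _]L2dotC L2dotDl.
Qed.

Lemma L2dotZl k u w : L2 Om u -> L2 Om w -> L2dot (fun x => k * u x) w = k * L2dot u w.
Proof.
move=> Lu Lw; rewrite /L2dot -RintegralZl//; last exact: L2_mul.
by apply: eq_Rintegral => x _; rewrite mulrA.
Qed.

Lemma L2dot_ge0 u : 0 <= L2dot u u.
Proof. by apply: Rintegral_ge0 => x _; rewrite -expr2 sqr_ge0. Qed.

Lemma L2dot_suml n (F : 'I_n -> 'rV[R]_m -> R) (c : 'I_n -> R) w :
  (forall k, L2 Om (F k)) -> L2 Om w ->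
  L2dot (fun x => \sum_k c k * F k x) w = \sum_k c k * L2dot (F k) w.
Proof.
move=> + Lw; elim: n F c => [|n IH] F c LF.
  rewrite big_ord0 -[RHS](mul0r (L2dot (fun=> 0) w)) -L2dotZl//; last exact: L2_0.
  by congr L2dot; apply/funext => x; rewrite big_ord0 mul0r.
rewrite big_ord_recl -IH//.
rewrite -L2dotZl// -L2dotDl//; [|exact: L2Z|apply: L2_sum => k; exact: LF].
by congr L2dot; apply/funext => x; rewrite big_ord_recl.
Qed.

Lemma L2dot_sum n k (F : 'I_n -> 'rV[R]_m -> R) (G : 'I_k -> 'rV[R]_m -> R) c d :
  (forall i, L2 Om (F i)) -> (forall j, L2 Om (G j)) ->
  L2dot (fun x => \sum_i c i * F i x) (fun x => \sum_j d j * G j x)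
  = \sum_i \sum_j c i * d j * L2dot (F i) (G j).
Proof.
move=> LF LG; rewrite L2dot_suml//; last exact: L2_sum.
apply: eq_bigr => i _; rewrite L2dotC L2dot_suml// mulr_sumr.
by apply: eq_bigr => j _; rewrite L2dotC mulrA.
Qed.

Lemma L2dot_cauchy_schwarz u v : L2 Om u -> L2 Om v ->
  L2dot u v ^+ 2 <= L2dot u u * L2dot v v.
Proof.
move=> Lu Lv; apply: discriminant_le => t.
have Ltv := L2Z t Lv; have := L2dot_ge0 (fun x => u x + t * v x).
rewrite L2dotDl//; last exact: L2D.
rewrite ![L2dot _ (fun x => u x + _)]L2dotC !L2dotDl// ?L2dotZl//; try exact: L2D.
rewrite ![L2dot _ (fun x => t * v x)]L2dotC ?L2dotZl// (L2dotC v u) => h.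
by apply: le_trans h _; rewrite le_eqVlt; apply/orP; left; apply/eqP; ring.
Qed.

End square_integrable.

(** * A null Lagrangian on H^1_0 *)

(** The estimate of the density argument below: a, b are squared norms of fixed
    functions, r1, r2 those of the approximation errors, y1, y2 their products. *)
Lemma small_difference (R : realFieldType) (a b r1 r2 e y1 y2 x1 x2 : R) :
  0 <= a -> 0 <= b -> 0 < e ->
  r1 < e / (2 * (a + b + 1)) -> r2 < e / (2 * (a + b + 1)) ->
  y2 ^+ 2 <= a * r2 -> y1 ^+ 2 <= b * r1 -> y2 + x1 = y1 + x2 ->
  (x1 - x2) ^+ 2 <= e.
Proof.
move=> a0 b0 e0; set d := e / _ => h1 h2 hy2 hy1 E.
have dE : 2 * (a + b + 1) * d = e.
  by rewrite /d mulrC divfK// gt_eqF// mulr_gt0//; lra.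
have -> : x1 - x2 = y1 - y2 by lra.
have d0 : 0 <= d by rewrite /d divr_ge0 ?(ltW e0)//; lra.
have := sqr_ge0 (y1 + y2); rewrite !expr2; nra.
Qed.

Section null_lagrangian.
Context {R : realType} (m : nat) (Om : set 'rV[R]_m).
Hypothesis oOm : open Om.
Implicit Types u v w : 'rV[R]_m -> R.
Local Notation leb := (@lebesgue_rV R m).
Let mOm : measurable Om := open_measurable_rV oOm.
Local Notation dot := (L2dot Om).
Local Notation wp := (weak_partial Om).

Lemma weak_partialP v i : H1 Om v -> is_weak_partial Om i v (wp i v).
Proof. by move=> [_ /(_ i) ex]; exact: xgetPex. Qed.

Lemma L2_weak_partial v i : H10 Om v -> L2 Om (wp i v).
Proof. by move=> [/(weak_partialP i)[]]. Qed.

(** Since d_i psi and d_j psi are test functions themselves, both sides are minus the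
    integral of u against the mixed second derivative of psi, by the definition of the
    weak derivatives of u alone. *)
Lemma L2dot_weak_partial_test u psi i j : H1 Om u -> test_function Om psi ->
  dot (wp i u) (partial j psi) = dot (wp j u) (partial i psi).
Proof.
move=> Hu tp; have [sp _] := tp.
have [_ wi] := weak_partialP i Hu; have [_ wj] := weak_partialP j Hu.
apply: oppr_inj.
apply: etrans (esym (wi _ (test_function_partial j tp))) _.
apply: etrans _ (wj _ (test_function_partial i tp)).
exact: (congr1 (fun F => \int[leb]_(x in Om) (u x * F x)) (partialC i j sp)).
Qed.

(** Convergence of extended-real integrals contains the eventual square integrability
    of the errors, because a value close to 0 is finite. *)
Lemma small_L2_error (r : nat -> 'rV[R]_m -> R) (e : R) :
  (forall k, measurable_fun Om (r k)) -> 0 < e ->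
  (\int[leb]_(x in Om) ((r k x) ^+ 2)%:E)%E @[k --> \oo] --> 0%E ->
  \forall k \near \oo, L2 Om (r k) /\ dot (r k) (r k) < e.
Proof.
move=> mr e0 cv.
have nb : nbhs 0%E [set y : \bar R | (y < e%:E)%E].
  exact: (@nbhs_open_ereal_lt _ 0 (fun=> e)).
have hcv : \forall k \near \oo,
    ((\int[leb]_(x in Om) ((r k x) ^+ 2)%:E) < e%:E)%E by exact: cv nb.
apply: filterS hcv => k hk.
have i0 : (0 <= \int[leb]_(x in Om) ((r k x) ^+ 2)%:E)%E.
  by apply: (@integral_ge0 _ _ _ leb) => x _; rewrite lee_fin sqr_ge0.
split.
  split=> //; apply/integrableP; split.
    by apply/measurable_EFinP; apply: measurable_funX.
  rewrite (eq_integral (fun x => ((r k x) ^+ 2)%:E)) ?(lt_trans hk) ?ltry//.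
  by move=> x _; rewrite abse_EFin ger0_norm ?sqr_ge0.
rewrite /L2dot /Rintegral (_ : (fun x => _) = (fun x => (r k x ^+ 2)%:E))//.
by move: hk i0; case: (integral _ _ _).
Qed.

(** The density d_i u d_j v - d_j u d_i v is a null Lagrangian: its integral vanishes as
    soon as one of the functions is in H^1_0. For v a test function this is the symmetry
    of second derivatives, and both integrals are continuous in v for the H^1 norm. *)
Lemma L2dot_weak_partial_swap u v i j : H1 Om u -> H10 Om v ->
  dot (wp i u) (wp j v) = dot (wp j u) (wp i v).
Proof.
move=> Hu Hv; have [_ [phi [tphi _ cphi]]] := Hv.
have [La _] := weak_partialP i Hu; have [Lb _] := weak_partialP j Hu.
set a := wp i u in La *; set b := wp j u in Lb *.
pose rr l k x := partial l (phi k) x - wp l v x.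
have Lw l := L2_weak_partial l Hv.
have mr l k : measurable_fun Om (rr l k).
  apply: measurable_funB; last by case: (Lw l).
  apply: continuous_measurable_rV => //.
  by have [+ _] := tphi k => /(_ [:: l])[].
have key l c k : L2 Om c -> L2 Om (rr l k) ->
    dot c (partial l (phi k)) = dot c (rr l k) + dot c (wp l v).
  move=> Lc Lr; apply: etrans _ (L2dotDr mOm Lr (Lw l) Lc).
  by apply: (congr1 (L2dot Om c)); apply/funext => x; rewrite /rr subrK.
apply/eqP; rewrite -subr_eq0 -sqrf_eq0 eq_le sqr_ge0 andbT.
apply/ler_addgt0Pr => e e0; rewrite add0r.
have Q0 : 0 < dot a a + dot b b + 1.
  by rewrite ltr_wpDl// addr_ge0//; exact: L2dot_ge0.
have d0 : 0 < e / (2 * (dot a a + dot b b + 1)) by rewrite divr_gt0// mulr_gt0.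
have Ni := small_L2_error (mr i) d0 (cphi i).
have Nj := small_L2_error (mr j) d0 (cphi j).
have [k [[Li hi] [Lj hj]]] := filter_ex (filterI Ni Nj).
have E : dot a (rr j k) + dot a (wp j v) = dot b (rr i k) + dot b (wp i v) :=
  etrans (esym (key j a k La Lj))
    (etrans (L2dot_weak_partial_test i j Hu (tphi k)) (key i b k Lb Li)).
exact: (small_difference (L2dot_ge0 Om a) (L2dot_ge0 Om b) e0 hi hj
  (L2dot_cauchy_schwarz mOm La Lj) (L2dot_cauchy_schwarz mOm Lb Li) E).
Qed.

End null_lagrangian.

(** * The coupling parameter bounds the Schur complement *)

Section finite_sums.
Context {R : realType} (m : nat) (Om : set 'rV[R]_m).
Hypothesis mOm : measurable Om.
Local Notation leb := (@lebesgue_rV R m).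

Lemma Rintegral_sum n (F : 'I_n -> 'rV[R]_m -> R) :
  (forall k, leb.-integrable Om (EFin \o F k)) ->
  leb.-integrable Om (EFin \o (fun x => \sum_k F k x)) /\
  \int[leb]_(x in Om) (\sum_k F k x) = \sum_k \int[leb]_(x in Om) F k x.
Proof.
elim: n F => [|n IH] F iF.
  split.
    rewrite (_ : _ \o _ = cst 0%E); first exact: integrable0.
    by apply/funext => x /=; rewrite big_ord0.
  rewrite [RHS]big_ord0 -[RHS](mul0r (fine (leb Om))) -Rintegral_cst//.
  by apply: eq_Rintegral => x _; rewrite big_ord0.
have [iS eS] := IH (fun k => F (lift ord0 k)) (fun k => iF _).
have E : (fun x => \sum_(k < n.+1) F k x) = (fun x => F ord0 x + \sum_(k < n) F (lift ord0 k) x).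
  by apply/funext => x; rewrite big_ord_recl.
rewrite E; split; first exact: (integrableD mOm (iF ord0) iS).
by rewrite big_ord_recl RintegralD// eS.
Qed.

Lemma L2_sum1 n (F : 'I_n -> 'rV[R]_m -> R) :
  (forall k, L2 Om (F k)) -> L2 Om (fun x => \sum_k F k x).
Proof.
move=> LF; rewrite (_ : (fun x => _) = fun x => \sum_k 1 * F k x); first exact: L2_sum.
by apply/funext => x; apply: eq_bigr => k _; rewrite mul1r.
Qed.

Lemma L2dot_sum1 n k (F : 'I_n -> 'rV[R]_m -> R) (G : 'I_k -> 'rV[R]_m -> R) :
  (forall i, L2 Om (F i)) -> (forall j, L2 Om (G j)) ->
  L2dot Om (fun x => \sum_i F i x) (fun x => \sum_j G j x)
  = \sum_i \sum_j L2dot Om (F i) (G j).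
Proof.
move=> LF LG.
have E l (H : 'I_l -> 'rV[R]_m -> R) : (fun x => \sum_i H i x) = fun x => \sum_i 1 * H i x.
  by apply/funext => x; apply: eq_bigr => i _; rewrite mul1r.
rewrite (E _ F) (E _ G) L2dot_sum//.
by apply: eq_bigr => i _; apply: eq_bigr => j _; rewrite !mul1r.
Qed.

(** The difference of the two sides is a quarter of the squared norm of f - g. *)
Lemma L2dot_le_mean f g : L2 Om f -> L2 Om g ->
  L2dot Om f g <= L2dot Om (fun x => 2^-1 * (f x + g x)) (fun x => 2^-1 * (f x + g x)).
Proof.
move=> Lf Lg; have LD := L2D mOm Lf Lg; have LN := L2Z mOm (-1) Lg.
have LB := L2D mOm Lf LN.
have h : 0 <= L2dot Om f f + L2dot Om g g - 2 * L2dot Om f g.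
  have := L2dot_ge0 Om (fun x => f x + -1 * g x).
  rewrite (L2dotDl mOm Lf LN LB) (L2dotDr mOm Lf LN Lf) (L2dotDr mOm Lf LN LN).
  rewrite (L2dotC Om f (fun x => -1 * g x)) !(L2dotZl mOm) //.
  by rewrite (L2dotC Om g (fun x => -1 * g x)) (L2dotZl mOm)// (L2dotC Om g f); lra.
rewrite (L2dotZl mOm) //; last exact: L2Z.
rewrite (L2dotC Om (fun x => f x + g x)) (L2dotZl mOm)//.
rewrite (L2dotDl mOm Lf Lg LD) (L2dotDr mOm Lf Lg Lf) (L2dotDr mOm Lf Lg Lg) (L2dotC Om g f).
by lra.
Qed.

(** Regroups the quadratic form of the elasticity matrix by strain components. *)
Lemma quad_sum (J I : finType) (c : I -> I -> R) (S : J -> J -> I -> I -> R)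
    (D : I -> I -> R) (s t : R) :
  \sum_i \sum_j c i j * (s * (\sum_a \sum_b S a b i j) + t * D i j) =
  s * (\sum_a \sum_b \sum_i \sum_j c i j * S a b i j) + t * (\sum_i \sum_j c i j * D i j).
Proof.
have -> : \sum_a \sum_b \sum_i \sum_j c i j * S a b i j
    = \sum_(r : J * J) \sum_(p : I * I) c p.1 p.2 * S r.1 r.2 p.1 p.2.
  by rewrite pair_bigA /=; apply: eq_bigr => r _; rewrite pair_bigA.
rewrite [LHS]pair_bigA [in t * _]pair_bigA /= exchange_big /= !mulr_sumr -big_split /=.
apply: eq_bigr => p _; rewrite pair_bigA /= -[in RHS]mulr_sumr.
by move: (\sum_(r : J * J) _) => Z; ring.
Qed.

End finite_sums.

Section forms_bound.
Context {R : realType} (m : nat) (Om : set 'rV[R]_m).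
Hypothesis oOm : open Om.
Local Notation leb := (@lebesgue_rV R m).
Local Notation wp := (weak_partial Om).
Let mOm : measurable Om := open_measurable_rV oOm.

Lemma dotv_form_mx (U W : Type) (form : U -> W -> R) n k
    (bc : 'I_n -> U) (br : 'I_k -> W) (q : 'cV[R]_k) (x : 'cV[R]_n) :
  dotv q (form_mx form bc br *m x)
  = \sum_i \sum_j q i ord0 * x j ord0 * form (bc j) (br i).
Proof.
rewrite dotvE; apply: eq_bigr => i _; rewrite mxE mulr_sumr.
by apply: eq_bigr => j _; rewrite mxE; ring.
Qed.

Lemma L2_divergence u : H10v Om u -> L2 Om (divergence Om u).
Proof. by move=> Hu; apply: L2_sum1 => // j; exact: L2_weak_partial. Qed.

Lemma strainE u x i j : strain Om u x i j =
  2^-1 * (wp i (component u j) x + wp j (component u i) x).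
Proof. by rewrite mxE. Qed.

Lemma L2_strain u i j : H10v Om u -> L2 Om (fun x => strain Om u x i j).
Proof.
move=> Hu.
rewrite (_ : (fun x => _) = fun x => 2^-1 *
  (wp i (component u j) x + wp j (component u i) x)).
  by apply: L2Z => //; apply: L2D => //; exact: L2_weak_partial.
by apply/funext => x; rewrite mxE.
Qed.

Lemma stressE mu lambda u x i j : stress Om mu lambda u x i j =
  2 * mu * strain Om u x i j + (lambda * divergence Om u x) *+ (i == j).
Proof. by rewrite /stress mxE [X in X + _]mxE [X in _ + X]mxE. Qed.

(** The trace of the strain is the divergence, whence the second term. *)
Lemma form_aE mu lambda u v : H10v Om u -> H10v Om v ->
  form_a Om mu lambda u v =
  2 * mu * (\sum_i \sum_j L2dot Om (fun x => strain Om u x i j) (fun x => strain Om v x i j))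
  + lambda * L2dot Om (divergence Om u) (divergence Om v).
Proof.
move=> Hu Hv.
have iS i j := L2_mul mOm (L2_strain i j Hu) (L2_strain i j Hv).
have iD := L2_mul mOm (L2_divergence Hu) (L2_divergence Hv).
have i1 i := Rintegral_sum mOm (iS i).
have i2 := Rintegral_sum mOm (fun i => (i1 i).1).
have tr x : divergence Om v x = \sum_i strain Om v x i i.
  by apply: eq_bigr => i _; rewrite strainE; field.
rewrite /form_a.
transitivity (\int[leb]_(x in Om) (2 * mu * (\sum_i \sum_j strain Om u x i j * strain Om v x i j)
   + lambda * (divergence Om u x * divergence Om v x))).
  apply: eq_Rintegral => x _; rewrite tr !mulr_sumr -big_split; apply: eq_bigr => i _ /=.
  rewrite [in RHS]mulr_sumr (bigD1 i)//= [in RHS](bigD1 i)//= stressE eqxx mulr1n.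
  rewrite (eq_bigr (fun j => 2 * mu * (strain Om u x i j * strain Om v x i j))).
    by move: (\sum_(_ < _ | _) _) (strain Om u x i i) (strain Om v x i i) => a b c; ring.
  by move=> j ji; rewrite stressE (eq_sym i) (negPf ji) mulr0n addr0 mulrA.
rewrite RintegralD//; last 2 first.
- exact: (integrableZl mOm _ i2.1).
- exact: (integrableZl mOm _ iD).
rewrite RintegralZl//; last exact: i2.1.
rewrite RintegralZl// i2.2; congr (_ * _ + _).
by apply: eq_bigr => i _; rewrite (i1 i).2.
Qed.

Lemma form_cE M p q : L2 Om p -> L2 Om q -> form_c Om M p q = M^-1 * L2dot Om p q.
Proof.
move=> Lp Lq; rewrite /L2dot -RintegralZl//; last exact: L2_mul.
by apply: eq_Rintegral => x _; rewrite mulrA.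
Qed.

Lemma form_dE al u q : H10v Om u -> L2 Om q ->
  form_d Om al u q = al * L2dot Om (divergence Om u) q.
Proof.
move=> Hu Lq; rewrite /L2dot -RintegralZl//; last exact: L2_mul (L2_divergence Hu) Lq.
by apply: eq_Rintegral => x _; rewrite mulrA.
Qed.

Section coefficients.
Variables (n_u : nat) (phi : 'I_n_u -> 'rV[R]_m -> 'rV[R]_m) (x : 'cV[R]_n_u).
Hypothesis Hphi : forall k, H10v Om (phi k).

Let G i j y := \sum_k x k ord0 * wp i (component (phi k) j) y.
Let E i j y := \sum_k x k ord0 * strain Om (phi k) y i j.
(** Weak derivatives are representatives chosen function by function, hence linear only
    almost everywhere. The divergence of the finite element function with coefficients
    x is therefore defined as the combination of the chosen representatives. *)
Definition div_comb y := \sum_k x k ord0 * divergence Om (phi k) y.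

Let LG i j : L2 Om (G i j).
Proof. by apply: L2_sum => // k; exact: (L2_weak_partial _ (Hphi k j)). Qed.

Let EG i j : E i j = fun y => 2^-1 * (G i j y + G j i y).
Proof.
apply/funext => y; rewrite /E /G -big_split mulr_sumr.
by apply: eq_bigr => k _ /=; rewrite strainE mulrCA mulrDr.
Qed.

Let divG : div_comb = fun y => \sum_j G j j y.
Proof.
apply/funext => y; rewrite /div_comb /G exchange_big /=.
by apply: eq_bigr => k _; rewrite mulr_sumr.
Qed.

Lemma L2_div_comb : L2 Om div_comb.
Proof. by apply: L2_sum => // k; exact: L2_divergence. Qed.

Let swapG a b : L2dot Om (G a b) (G b a) = L2dot Om (G b b) (G a a).
Proof.
apply: etrans (L2dot_sum mOm _ _ _ _) _.
- by move=> k; exact: (L2_weak_partial _ (Hphi k b)).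
- by move=> k; exact: (L2_weak_partial _ (Hphi k a)).
apply: etrans _ (esym (L2dot_sum mOm _ _ _ _)).
- apply: eq_bigr => k _; apply: eq_bigr => l _.
  apply: (congr1 (fun r => _ * r)).
  by apply: (L2dot_weak_partial_swap oOm a b); [have [] := Hphi k b | exact: Hphi].
- by move=> k; exact: (L2_weak_partial _ (Hphi k b)).
- by move=> k; exact: (L2_weak_partial _ (Hphi k a)).
Qed.

Lemma sqnorm_form_a mu lambda : sqnorm (form_mx (form_a Om mu lambda) phi phi) x
  = 2 * mu * (\sum_i \sum_j L2dot Om (E i j) (E i j)) + lambda * L2dot Om div_comb div_comb.
Proof.
rewrite sqnormE dotv_form_mx.
transitivity (\sum_i \sum_j x i ord0 * x j ord0 * (2 * mu *
   (\sum_a \sum_b L2dot Om (fun y => strain Om (phi j) y a b) (fun y => strain Om (phi i) y a b))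
  + lambda * L2dot Om (divergence Om (phi j)) (divergence Om (phi i)))).
  by apply: eq_bigr => i _; apply: eq_bigr => j _; rewrite form_aE.
rewrite (quad_sum (fun i j => x i ord0 * x j ord0)); congr (_ * _ + _ * _).
  apply: eq_bigr => a _; apply: eq_bigr => b _.
  rewrite exchange_big.
  apply: etrans _ (esym (L2dot_sum mOm _ _ _ _)); try by move=> k; exact: L2_strain.
  by apply: eq_bigr => i _; apply: eq_bigr => j _; congr (_ * _); rewrite mulrC.
rewrite exchange_big.
apply: etrans _ (esym (L2dot_sum mOm _ _ _ _)); try by move=> k; exact: L2_divergence.
by apply: eq_bigr => i _; apply: eq_bigr => j _; congr (_ * _); rewrite mulrC.
Qed.

(** With G the gradient, |E_ij|^2 dominates G_ij G_ji for each i and j. The integral of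
    the latter is that of G_jj G_ii by the null Lagrangian identity, and the sum of
    these over i and j is the integral of the squared divergence. *)
Lemma div_le_elastic_energy mu lambda : 0 <= mu ->
  (mu + lambda) * L2dot Om div_comb div_comb
    <= sqnorm (form_mx (form_a Om mu lambda) phi phi) x.
Proof.
move=> mu0; rewrite sqnorm_form_a.
have h : L2dot Om div_comb div_comb <= \sum_i \sum_j L2dot Om (E i j) (E i j).
  rewrite divG (L2dot_sum1 mOm)// exchange_big /=.
  apply: ler_sum => a _; apply: ler_sum => b _.
  by rewrite -swapG EG; exact: L2dot_le_mean.
have := L2dot_ge0 Om div_comb; nra.
Qed.

End coefficients.

(** Continuity of the coupling form in the energy norms of the two fields, with the
    squared constant equal to the coupling parameter. *)
Lemma coupling_bound (n_u n_p : nat) (phi : 'I_n_u -> 'rV[R]_m -> 'rV[R]_m)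
    (psi : 'I_n_p -> 'rV[R]_m -> R) (mu lambda al M : R) (x : 'cV_n_u) (q : 'cV_n_p) :
  (forall k, H10v Om (phi k)) -> (forall k, H10 Om (psi k)) ->
  0 <= mu -> 0 < lambda + mu -> 0 < M ->
  dotv q (form_mx (form_d Om al) phi psi *m x) ^+ 2 <=
  al ^+ 2 * M / (mu + lambda) * sqnorm (form_mx (form_a Om mu lambda) phi phi) x
   * sqnorm (form_mx (form_c Om M) psi psi) q.
Proof.
move=> Hphi Hpsi mu0 lm0 M0.
have Lpsi k : L2 Om (psi k) by have [[]] := Hpsi k.
pose Q y := \sum_k q k ord0 * psi k y.
have LQ : L2 Om Q by exact: L2_sum.
have LD := L2_div_comb x Hphi.
have -> : dotv q (form_mx (form_d Om al) phi psi *m x) = al * L2dot Om (div_comb phi x) Q.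
  rewrite dotv_form_mx (L2dot_sum mOm)//; last by move=> k; exact: L2_divergence.
  rewrite exchange_big mulr_sumr; apply: eq_bigr => j _; rewrite mulr_sumr.
  by apply: eq_bigr => i _; rewrite form_dE//; ring.
have -> : sqnorm (form_mx (form_c Om M) psi psi) q = M^-1 * L2dot Om Q Q.
  rewrite sqnormE dotv_form_mx (L2dot_sum mOm)// mulr_sumr; apply: eq_bigr => i _.
  rewrite mulr_sumr; apply: eq_bigr => j _; rewrite form_cE// (L2dotC Om (psi j)).
  by rewrite mulrCA.
have h1 := div_le_elastic_energy x Hphi lambda mu0.
have h2 := L2dot_cauchy_schwarz mOm LD LQ.
have hQ := L2dot_ge0 Om Q; have hD := L2dot_ge0 Om (div_comb phi x).
move: h1 h2 hQ hD; set a := sqnorm _ x; move: (L2dot Om _ Q) (L2dot Om Q Q) (L2dot Om _ _).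
move=> dq qq dd h1 h2 hQ hD.
have -> : al ^+ 2 * M / (mu + lambda) * a * (M^-1 * qq) = al ^+ 2 * (a / (mu + lambda) * qq).
  by field; rewrite !gt_eqF//; lra.
rewrite exprMn ler_wpM2l ?sqr_ge0// (le_trans h2)// ler_wpM2r//.
by rewrite ler_pdivlMr 1?mulrC//; lra.
Qed.

End forms_bound.

(** * Order of convergence *)

Theorem theorem4p4 (R : realType) (m : nat) (Om : set 'rV[R]_m)
    (T lambda mu alpha M kappa nu : R) (n_u n_p : nat)
    (phi : 'I_n_u -> 'rV[R]_m -> 'rV[R]_m) (psi : 'I_n_p -> 'rV[R]_m -> R)
    (A : 'M[R]_n_u) (B C : 'M[R]_n_p) (D : 'M[R]_(n_p, n_u))
    (f : R -> 'cV[R]_n_u) (g : R -> 'cV[R]_n_p) (K : nat)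
    (I := [set t : R | 0 <= t <= T])
    (omega := alpha ^+ 2 * M / (mu + lambda)) :
  m = 2%N \/ m = 3%N ->
  bounded_lipschitz_domain Om ->
  0 < T ->
  0 < mu -> 0 < lambda + mu -> 0 < alpha -> 0 < M -> 0 < kappa -> 0 < nu ->
  (forall i, H10v Om (phi i)) -> lin_indep Om phi ->
  (forall i, H10 Om (psi i)) -> lin_indep Om (psi : _ -> _ -> R^o) ->
  A = form_mx (form_a Om mu lambda) phi phi ->
  B = form_mx (form_b Om kappa nu) psi psi ->
  C = form_mx (form_c Om M) psi psi ->
  D = form_mx (form_d Om alpha) phi psi ->
  spd A -> spd B -> spd C -> row_free D ->
  Ck I 2 f -> Ck I 1 g ->
  (1 <= K)%N ->
  omega ^+ K / (2 + omega) ^+ (K - 1) < 1 ->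
  forall L c0 : R, exists2 Cst : R, 0 < Cst &
    forall N : nat, (1 <= N)%N -> let tau := T / N%:R in
    forall (u0 : 'cV[R]_n_u) (p0 : 'cV[R]_n_p)
           (u : R -> 'cV[R]_n_u) (p : R -> 'cV[R]_n_p),
    semi_discrete_solution A B C D f g I u0 p0 u p ->
    Ck I 2 u -> Ck I 2 p -> Ck_bounded I 2 L u -> Ck_bounded I 2 L p ->
    A *m u0 - D^T *m p0 = f 0 ->
    `|B *m p0 - (g 0 - D *m invmx A *m derive_on I f 0)| <= c0 * tau ->
    forall (un : nat -> 'cV[R]_n_u) (pn : nat -> 'cV[R]_n_p),
    damped_scheme A B C D f g tau (2 / (2 + omega)) K N u0 p0 un pn ->
    forall n : nat, (n <= N)%N ->
      sqnorm A (un n - u (n%:R * tau)) + sqnorm B (pn n - p (n%:R * tau))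
        <= Cst * tau ^+ 2.
Proof.
move=> _ [oOm _ _ _ _] T0 mu0 lm0 al0 M0 _ _ Hphi _ Hpsi _ eA _ eC eD sA sB sC _ _ _ K1 rho1.
have w0 : 0 < omega.
  by apply: divr_gt0; [apply: mulr_gt0 => //; exact: exprn_gt0|rewrite addrC].
have SC q : sqnorm (schur A D) q <= omega * sqnorm C q.
  (* for this x both q^T D x and x^T A x equal the S-energy of q, so that one factor of
     it cancels in the coupling bound *)
  pose x := invmx A *m (D^T *m q).
  have Ax : A *m x = D^T *m q by rewrite mulmxA mulmxV ?mul1mx ?spd_unitmx.
  have Sx := sqnorm_schur_mul sA Ax.
  have Dx : dotv q (D *m x) = sqnorm (schur A D) q by rewrite (schur_mul sA Ax) -sqnormE.
  have := @coupling_bound _ _ _ oOm _ _ phi psi mu lambda alpha M x q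
    Hphi Hpsi (ltW mu0) lm0 M0.
  rewrite -eD -eA -eC Dx Sx -/omega => h.
  have [_ S0] := psd_schur D sA; have := S0 q; rewrite le_eqVlt => /predU1P[<-|s0].
    by apply: mulr_ge0; [exact: ltW|have [_ ->] := spd_psd sC].
  by rewrite -(ler_pM2l s0) -expr2 mulrCA mulrA.
move=> L c0.
have [Cst Cst0 hC] := damped_scheme_order_one sA sB sC f g L T0 w0 SC K1 rho1.
exists Cst => // N N1 tau u0 p0 u p sol Cu Cp Lu Lp _ _ un pn sch.
exact: hC sol Cu Cp Lu Lp un pn sch.
Qed.
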